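(* Let $f\in\mathbb{Z}[x]$ be irreducible over $\mathbb{Q}$ with degree $d\ge 2$, and for each positive integer $N$ let $\ell_f(N)=\operatorname{rad}\operatorname{lcm}(f(1),\ldots,f(N))$. Then $\log\ell_f(N)\gtrsim\frac{2}{d}N\log N$ as $N\to\infty$; that is, for every $\epsilon>0$ there is $N_0$ (depending on $f$ and $\epsilon$) such that $\frac{2}{d}N\log N\le(1+\epsilon)\log\ell_f(N)$ for all integers $N\ge N_0$.
   Context: For a positive integer $m$, $\operatorname{rad}(m)$ is the product of the distinct primes dividing $m$. The least common multiple is taken to be a positive integer; values of $0$ are ignored in the LCM, and the LCM of an empty set is $1$. ''Irreducible over $\mathbb{Q}$'' means irreducible as an element of $\mathbb{Q}[x]$ (so $f$ need not be primitive). *)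

(* Defs.v *)
From HB Require Import structures.
From mathcomp Require Import all_boot all_order all_algebra.

Set Implicit Arguments.
Unset Strict Implicit.
Unset Printing Implicit Defensive.

Import GRing.Theory.
Local Open Scope ring_scope.

Definition rad (m : nat) : nat := (\prod_(p <- primes m) p)%N.

(* The lcm of the absolute values of the nonzero f(n), 1 <= n <= N;
   it is 1 when there are none. *)
Definition lcm_values (f : {poly int}) (N : nat) : nat :=
  \big[lcmn/1%N]_(1 <= n < N.+1 | f.[n%:Z] != 0) `|f.[n%:Z]|%N.

Definition ell (f : {poly int}) (N : nat) : nat := rad (lcm_values f N).

(* Main.v *)
Require Import Defs.
From HB Require Import structures.
From mathcomp Require Import all_boot all_order perm all_algebra.
From mathcomp Require Import reals exp.
From mathcomp Require Import zify ring lra.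

(** Following Sah.  After replacing [f] by [+-f(x + a)] we get [g] of degree [d]
    with nonnegative coefficients, and we compare two evaluations of
    [sum_{m <= M} ln g(m) = sum_p alpha_p ln p >= d (M ln M - M)], where
    [alpha_p] is the exponent of [p] in [g(1) ... g(M)].

    - Primes [p > K M] have [alpha_p <= d (d - 1) / 2].  Order the [m] by
      decreasing valuation: the [k]-th valuation [e] has [p ^ e] dividing the
      divided difference [g[m_1, ..., m_k]], which is positive and
      [O(M ^ (d - k + 1)) < p ^ (d - k + 1)], hence [e <= d - k].
    - Primes [p <= K M] contribute at most [(1 + o(1)) M ln M].  Up to
      negligible terms this is [M sum_p rho(p) ln p / p], with [rho(p)] the
      number of roots of [g] mod [p], so we need
      [sum_{p <= x} rho(p) ln p / p <= (1 + o(1)) ln x].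

    The last bound is Mertens' theorem for the number field of a root [theta],
    of which the upper half has a direct proof.  The norms of the elements of
    [Z[theta]] with coordinates in [1, ..., T] are [O(T ^ d)].  A root [r] mod
    [p] gives a prime ideal of norm [p], and a nonzero element of it has norm at
    least [p], so small boxes inject into the quotient [F_p].  Such an image has
    positive density, hence boxes of side [O(p ^ (1 / d))] surject onto [F_p]
    and about [T ^ d / p] elements of the box lie in the ideal for all
    [p <= c T ^ d].  Summing the logarithms of the norms over the box gives
    the bound.

    Consequently [d (d - 1) / 2] times the sum of [ln p] over the large primes
    dividing some [g(m)] is at least [(d - 1 - o(1)) M ln M]. *)

Set Implicit Arguments.
Unset Strict Implicit.
Unset Printing Implicit Defensive.

Import Order.TTheory GRing.Theory Num.Theory.
Local Open Scope ring_scope.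

(** * Large primes *)

(** The coefficients of [(g(x) - g(a)) / (x - a)] are written out so that, for [a >= 0], their signs
    and sizes can be read off from those of [g]. *)
Definition horner_quo (g : {poly int}) (a : int) : {poly int} :=
  \poly_(j < (size g).-1) \sum_(j.+1 <= i < size g) g`_i * a ^+ (i - j.+1).

Lemma horner_quoP (g : {poly int}) a x : g.[x] - g.[a] = (x - a) * (horner_quo g a).[x].
Proof.
rewrite /horner_quo horner_poly !horner_coef.
case: (size g) => [|n] /=; first by rewrite !big_ord0 subrr mulr0.
rewrite -sumrB.
have -> : \sum_(j < n) (\sum_(j.+1 <= i < n.+1) g`_i * a ^+ (i - j.+1)) * x ^+ j
   = \sum_(i < n.+1) g`_i * \sum_(j < i) a ^+ (i - j.+1) * x ^+ j.
  transitivity (\sum_(j < n.+1) \sum_(i < n.+1 | (j < i)%N) g`_i * a ^+ (i - j.+1) * x ^+ j).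
    rewrite [RHS]big_ord_recr /= [X in _ = _ + X]big_pred0 ?addr0; last first.
      by move=> i; rewrite ltnNge -ltnS ltn_ord.
    apply: eq_bigr => j _; rewrite mulr_suml.
    rewrite big_geq_mkord; apply: eq_bigl => i; by [].
  rewrite (exchange_big_dep xpredT) //=; apply: eq_bigr => i _.
  rewrite mulr_sumr (big_ord_widen_cond n.+1 xpredT (fun j : nat => g`_i * (a ^+ (i - j.+1) * x ^+ j))) ?(ltnW (ltn_ord i)) //.
  by apply: eq_bigr => j _; rewrite mulrA.
rewrite mulr_sumr; apply: eq_bigr => i _.
rewrite -mulrBr -[_ ^+ _ - _]opprB subrXX -mulNr opprB mulrCA; congr (_ * (_ * _)).
by apply: eq_bigr => j _; rewrite -subn1 -subnDA add1n.
Qed.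

Lemma size_horner_quo (g : {poly int}) a k : size g = k.+2 -> 0 < lead_coef g ->
  size (horner_quo g a) = k.+1.
Proof.
move=> sg lg; rewrite /horner_quo sg /= size_poly_eq //.
rewrite big_nat1 subnn expr0 mulr1.
by move: lg; rewrite lead_coefE sg /= => /gt_eqF ->.
Qed.

Lemma ler_expz_nat (m n i : nat) : (m <= n)%N -> m%:Z ^+ i <= (n ^ i)%N%:Z.
Proof. by move=> mn; rewrite -[X in _ <= X]natz natrX natz lerXn2r ?nnegrE. Qed.

(* [horner_quo g n] is the divided difference [g[n, x]]; iterating it down the
   list keeps coefficients nonnegative and multiplies [C] by at most [k]. *)
Lemma sum_exponents_le p : prime p -> forall (s : seq nat) (e : nat -> nat) k (g : {poly int}) (C N : nat),
  size g = k.+1 -> (forall i, 0 <= g`_i) -> (forall i, (i <= k)%N -> g`_i <= (C * N ^ (k - i))%N%:Z) ->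
  (k.+1`! * C < p)%N -> (k.+1`! * C * N < p)%N -> (N < p)%N ->
  uniq s -> {in s, forall n, (0 < n <= N)%N} -> sorted (fun m n => e n <= e m)%N s ->
  {in s, forall n : nat, ((p ^ e n)%N%:Z %| g.[n%:Z])%Z} ->
  (\sum_(n <- s) e n <= 'C(k, 2))%N.
Proof.
move=> p_pr; elim=> [|n s IHs] e k g C N sg g0 gC pC pCN pN; first by rewrite big_nil.
move=> us sN se sd.
have lg : 0 < lead_coef g.
  by rewrite lt_def lead_coef_eq0 -size_poly_eq0 sg /= lead_coefE g0.
have /andP[n0 nN] : (0 < n <= N)%N by apply: sN; rewrite mem_head.
have gn0 : 0 < g.[n%:Z].
  rewrite horner_coef sg big_ord_recr /=; apply: ltr_wpDl.
    by apply: sumr_ge0 => i _; rewrite mulr_ge0 ?g0 ?exprn_ge0.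
  by rewrite mulr_gt0 ?exprn_gt0 ?ltz_nat //; move: lg; rewrite lead_coefE sg.
have gnle : g.[n%:Z] <= (k.+1 * C * N ^ k)%N%:Z.
  rewrite horner_coef sg.
  apply: (@le_trans _ _ (\sum_(i < k.+1) (C * N ^ k)%N%:Z)); last first.
    by rewrite sumr_const card_ord -mulnA -mulr_natl natz -PoszM.
  apply: ler_sum => i _; have ik : (i <= k)%N by rewrite -ltnS.
  apply: (@le_trans _ _ ((C * N ^ (k - i))%N%:Z * (N ^ i)%N%:Z)).
    apply: ler_pM; rewrite ?g0 ?exprn_ge0 ?gC //.
    exact: ler_expz_nat.
  by rewrite -PoszM -mulnA -expnD subnK.
have egn : (p ^ e n <= k.+1 * C * N ^ k)%N.
  rewrite -lez_nat; apply: le_trans gnle.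
  have := sd n (mem_head _ _); move: gn0; case: (g.[n%:Z]) => // m m0.
  by rewrite /dvdz /= lez_nat => /dvdn_leq; apply.
have es : {in s, forall m, (e m <= e n)%N}.
  move: se => /=; rewrite path_sortedE; last by move=> ? ? ? /[swap]; apply: leq_trans.
  by case/andP => /allP.
rewrite big_cons.
(* For [k = 0], [g] is a constant at most [C < p], so the largest exponent is already [0]. *)
case: k => [|k] in sg gC pC pCN gnle egn *.
  have en : e n = 0%N.
    move: egn; case: (e n) => // m; rewrite expn0 !muln1 mul1n => pm.
    have := leq_trans (leq_pexp2l (prime_gt0 p_pr) (ltn0Sn m)) pm.
    by rewrite expn1 leqNgt; move: pC; rewrite -[1`!]/1%N mul1n => ->.
  by rewrite en big_seq big1 // => m /es; rewrite en leqn0 => /eqP.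
(* Here [p ^ e n < p * N ^ k <= p ^ k.+1]. The other exponents fall to the induction hypothesis for
   the quotient, of degree [k]. *)
have enk : (e n <= k)%N.
  rewrite -ltnS -(ltn_exp2l _ _ (prime_gt1 p_pr)).
  apply: (leq_ltn_trans egn).
  have N0 : (0 < N)%N by apply: leq_trans nN.
  apply: (@leq_ltn_trans (k.+2`! * C * N * N ^ k)).
    rewrite expnS !mulnA !leq_mul2r; apply/orP; right; apply/orP; right; apply/orP; right.
    by rewrite factS leq_pmulr ?fact_gt0.
  rewrite (expnS p); apply: (@leq_trans (p * N ^ k)).
    by rewrite ltn_pmul2r ?expn_gt0 ?N0.
  rewrite leq_pmul2l ?prime_gt0 //.
  by case: (k) => [|j]; rewrite ?expn0 // leq_exp2r // ltnW.
rewrite binS bin1 addnC; apply: leq_add => //.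
pose q := horner_quo g n%:Z.
have sq : size q = k.+1 by apply: size_horner_quo.
have s0 m : m \in s -> (0 < m <= N)%N by move=> ms; apply: sN; rewrite inE ms orbT.
have hq i : q`_i = if (i < k.+1)%N then \sum_(i.+1 <= j < k.+2) g`_j * n%:Z ^+ (j - i.+1) else 0.
  by rewrite coef_poly sg.
have qC : (k.+1`! * (k.+1 * C) <= k.+2`! * C)%N.
  by rewrite mulnA leq_mul2r [k.+2`!]factS mulnC leq_mul2r leqnSn !orbT.
apply: (IHs _ _ q (k.+1 * C)%N N) => //.
- move=> i; rewrite hq; case: ifP => // _; apply: sumr_ge0 => j _.
  by rewrite mulr_ge0 ?g0 ?exprn_ge0.
- move=> i ik; rewrite hq ltnS ik.
  apply: (@le_trans _ _ (\sum_(i.+1 <= j < k.+2) (C * N ^ (k - i))%N%:Z)).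
    rewrite big_nat_cond [leRHS]big_nat_cond; apply: ler_sum => j /andP[/andP[ij jk] _].
    apply: (@le_trans _ _ ((C * N ^ (k.+1 - j))%N%:Z * (N ^ (j - i.+1))%N%:Z)).
      apply: ler_pM; rewrite ?g0 ?exprn_ge0 ?gC //.
      exact: ler_expz_nat.
    by rewrite -PoszM -mulnA -expnD lez_nat; have -> : (k.+1 - j + (j - i.+1) = k - i)%N by lia.
  rewrite sumr_const_nat -mulr_natl natz -PoszM lez_nat mulnA !leq_mul2r.
  by apply/orP; right; apply/orP; right; lia.
- exact: leq_ltn_trans qC pC.
- by apply: leq_ltn_trans pCN; rewrite leq_mul2r qC orbT.
- by case/andP: us.
- by move: se => /= /path_sorted.
(* As [e m <= e n], [p ^ e m] divides [g(m) - g(n) = (m - n) q(m)]; since [0 < |m - n| < p], it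
   divides [q(m)]. *)
- move=> m ms; have mn : m != n by apply: contraNneq (proj1 (andP us)) => <-.
  have: ((p ^ e m)%N%:Z %| g.[m%:Z] - g.[n%:Z])%Z.
    apply: rpredB; first by rewrite sd // inE ms orbT.
    apply: dvdz_trans (sd n (mem_head _ _)).
    by rewrite dvdzE !absz_nat dvdn_exp2l // es.
  rewrite horner_quoP Gauss_dvdzr //.
  rewrite /coprimez /gcdz /=; change (coprime (p ^ e m) `|m%:Z - n%:Z|%N).
  rewrite coprimeXl // prime_coprime //; apply/negP => /dvdn_leq.
  by have := s0 _ ms; lia.
Qed.

Lemma sum_logn_large_prime (g : {poly int}) (d : nat) :
  size g = d.+1 -> (forall i, 0 <= g`_i) ->
  exists K : nat, forall M p : nat, (0 < M)%N -> prime p -> (K * M < p)%N ->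
    (\sum_(1 <= n < M.+1) logn p `|g.[n%:Z]|%N <= 'C(d, 2))%N.
Proof.
move=> sg g0; pose C := (\sum_(i < size g) `|(g`_i)%R|)%N.
(* With [C] the sum of the [|g_i|], this single constant yields all three lower bounds on [p]
   required by [sum_exponents_le]. *)
exists (d.+1`! * C + 1)%N => M p M0 p_pr pK.
have pn : (d.+1`! * C * M + M < p)%N by rewrite -{2}[M]mul1n -mulnDl.
pose e n := logn p `|g.[n%:Z]|%N; pose s := sort (fun m n => e n <= e m)%N (index_iota 1 M.+1).
have ps : perm_eq s (index_iota 1 M.+1) by rewrite /s; apply/permPl/perm_sort.
rewrite -(perm_big _ ps) /=; apply: (sum_exponents_le p_pr (C := C) (N := M) sg) => //.
- move=> i id; apply: (@le_trans _ _ C%:Z).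
    rewrite -[g`_i]gez0_abs // lez_nat /C sg.
    by rewrite (bigD1 (Ordinal (id : (i < d.+1)%N))) //= leq_addr.
  by rewrite lez_nat leq_pmulr // expn_gt0 M0.
- by apply: leq_ltn_trans pn; rewrite (leq_trans _ (leq_addr _ _)) // leq_pmulr.
- exact: leq_ltn_trans (leq_addr _ _) pn.
- exact: leq_ltn_trans (leq_addl _ _) pn.
- by rewrite (perm_uniq ps) iota_uniq.
- by move=> n; rewrite (perm_mem ps) mem_index_iota.
- by apply: sort_sorted => m n; apply: leq_total.
- by move=> n _; rewrite /dvdz /=; apply: pfactor_dvdnn.
Qed.

(** * Norms as determinants *)

Lemma irreducible_coprime_small (F : fieldType) (p q : {poly F}) :
  irreducible_poly p -> q != 0 -> (size q < size p)%N -> coprimep p q.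
Proof.
move=> p_irr q0 qp; rewrite irreducible_poly_coprime //.
by apply/negP => /dvdp_leq; rewrite leqNgt qp; apply/implyP; rewrite q0.
Qed.

(* [lead_coef f] times the companion matrix of [f / lead_coef f]: it has integer
   entries, eigenvalues [lead_coef f * theta], and
   [\det (horner_mx (scaled_companion f n) h)] is the norm of
   [h (lead_coef f * theta)]. *)
Definition scaled_companion (f : {poly int}) (n : nat) : 'M[int]_n.+1 :=
  \matrix_(i, j) if i == n :> nat then - f`_j
                 else if i.+1 == j :> nat then lead_coef f else 0.

Lemma horner_mx_sum (R : comNzRingType) n (A : 'M[R]_n.+1) (p : {poly R}) m :
  (size p <= m)%N -> horner_mx A p = \sum_(i < m) p`_i *: A ^+ i.
Proof.
move=> pm; have -> : p = \sum_(i < m) p`_i *: 'X^i.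
  by rewrite -poly_def; apply/polyP => i; rewrite coef_poly; case: ltnP => // /(leq_trans pm) /leq_sizeP ->.
rewrite rmorph_sum; apply: eq_bigr => i _.
rewrite -poly_def coef_poly ltn_ord /=.
by rewrite linearZ rmorphXn /= horner_mx_X.
Qed.

Lemma horner_mx_comp_scale (R : comNzRingType) n (A : 'M[R]_n.+1) (p : {poly R}) (a : R) :
  horner_mx A (p \Po (a *: 'X)) = horner_mx (a *: A) p.
Proof.
elim/poly_ind: p => [|p c IHp]; first by rewrite comp_poly0 !rmorph0.
rewrite comp_polyD comp_polyM comp_polyX comp_polyC !rmorphD !rmorphM /= IHp.
by rewrite linearZ /= !horner_mx_X !horner_mx_C.
Qed.

(** Dividing by the leading coefficient [a] gives the companion matrix [B], for which the first
    basis row vector is cyclic and killed by [f(B)]. As [h = g(a X)] is coprime to [f], a Bezout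
    relation [u f + v h = c] makes [h(B) v(B)] the nonzero scalar [c]. *)
Lemma det_horner_companion_neq0 (f g : {poly int}) n :
  irreducible_poly (map_poly intr f : {poly rat}) -> size f = n.+2 ->
  g != 0 -> (size g <= n.+1)%N -> \det (horner_mx (scaled_companion f n) g) != 0.
Proof.
move=> f_irr sf g0 sg.
have inj : injective (intr : int -> rat) by exact: intr_inj.
pose a : rat := (lead_coef f)%:~R.
have a0 : a != 0 by rewrite intr_eq0 lead_coef_eq0 -size_poly_eq0 sf.
set fQ := map_poly intr f in f_irr *; pose gQ : {poly rat} := map_poly intr g.
have sfQ : size fQ = n.+2 by rewrite size_map_inj_poly.
have sgQ : size gQ = size g by rewrite size_map_inj_poly.
pose A : 'M[rat]_n.+1 := map_mx intr (scaled_companion f n).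
pose B := a^-1 *: A; pose h := gQ \Po (a *: 'X).
have AB : A = a *: B by rewrite scalerA divff // scale1r.
have dA : (\det (horner_mx (scaled_companion f n) g))%:~R = \det (horner_mx B h).
  by rewrite horner_mx_comp_scale -AB -map_horner_mx det_map_mx.
suff : \det (horner_mx B h) != 0 by rewrite -dA intr_eq0.
have sh : size h = size g by rewrite size_comp_poly2 ?sgQ // size_scale ?size_polyX.
have co : coprimep fQ h.
  apply: irreducible_coprime_small => //; last by rewrite sh sfQ ltnS.
  by rewrite -size_poly_eq0 sh size_poly_eq0.
have la : f`_n.+1 = lead_coef f by rewrite lead_coefE sf.
have Brow (i : 'I_n.+1) : (i < n)%N -> delta_mx 0 i *m B = delta_mx 0 (inord i.+1) :> 'rV_n.+1.
  move=> ltin; rewrite -rowE; apply/rowP => j; rewrite !mxE (ltn_eqF ltin) /= eq_sym.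
  rewrite -val_eqE /= inordK ?ltnS //.
  by case: eqP => _; rewrite ?mulVf ?mulr0.
have eB i : (i <= n)%N -> delta_mx 0 0 *m B ^+ i = delta_mx 0 (inord i) :> 'rV_n.+1.
  elim: i => [_|i IHi lin].
    by rewrite expr0 mulmx1; congr delta_mx; apply/val_inj; rewrite /= inordK.
  rewrite exprSr mulmxA IHi 1?ltnW // Brow inordK // ltnW //.
have ef : delta_mx 0 0 *m horner_mx B fQ = 0 :> 'rV_n.+1.
  rewrite (horner_mx_sum _ (eq_leq sfQ)) mulmx_sumr big_ord_recr /= exprSr.
  rewrite -scalemxAr mulmxA eB // -rowE; apply/rowP => j; rewrite !mxE summxE.
  rewrite inordK // eqxx (bigD1 j) //= big1 => [|i ij].
    rewrite addr0 -scalemxAr eB -1?ltnS // !mxE inord_val !eqxx mulr1.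
    rewrite coef_map /= [fQ`_n.+1]coef_map /= la -/a.
    by rewrite mulrA divff // mul1r rmorphN addrN.
  by rewrite -scalemxAr eB -1?ltnS // !mxE inord_val [j == i]eq_sym (negPf ij) andbF mulr0.
have /Bezout_coprimepP[[u v] /= ] := co.
rewrite -size_poly_eq1 => /size_poly1P[c c0 uvc].
have ev : delta_mx 0 0 *m (horner_mx B h * horner_mx B v) = c *: delta_mx 0 0 :> 'rV_n.+1.
  have := congr1 (horner_mx B) uvc; rewrite horner_mx_C rmorphD !rmorphM /= => E.
  have := congr1 (mulmx (delta_mx 0 0 : 'rV_n.+1)) E.
  rewrite mulmxDr mul_mx_scalar [horner_mx B u * _]comm_horner_mx2 mulmxA ef mul0mx add0r.
  by rewrite [horner_mx B v * _]comm_horner_mx2.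
(* The identity known on [e_0] extends to each [e_i = e_0 B ^ i], since polynomials in [B]
   commute. *)
have hv : horner_mx B h *m horner_mx B v = c%:M.
  apply/row_matrixP => i; rewrite !rowE mul_mx_scalar.
  have := eB i; rewrite -ltnS ltn_ord inord_val => /(_ isT) <-.
  rewrite -mulmxA -[B ^+ i *m _]/(B ^+ i * (horner_mx B h * horner_mx B v)).
  rewrite -rmorphM /= -{1}[B]horner_mx_X -rmorphXn /= comm_horner_mx2 rmorphM rmorphXn /= horner_mx_X.
  by rewrite mulmxA ev scalemxAl.
by apply: contraNneq c0 => dh; have := congr1 determinant hv;
  rewrite det_mulmx dh mul0r det_scalar => /esym/eqP; rewrite expf_eq0.
Qed.

(** The entries of [g(A)] are linear in the coefficients of [g], hence [O(T)], and each Leibniz term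
    is a product of [n.+1] of them. *)
Lemma det_horner_mx_le n (A : 'M[int]_n.+1) :
  exists2 C : nat, (0 < C)%N & forall (g : {poly int}) (T : nat),
    (size g <= n.+1)%N -> (forall i, `|g`_i| <= T%:Z) ->
    (`|\det (horner_mx A g)| <= C * T ^ n.+1)%N.
Proof.
pose E : nat := \max_(i < n.+1) \max_k \max_l absz ((A ^+ i) k l).
exists (n.+1`! * (n.+1 * E.+1) ^ n.+1)%N; first by rewrite muln_gt0 fact_gt0 expn_gt0.
move=> g T sg gT; have entry k l : `|horner_mx A g k l| <= (n.+1 * E.+1 * T)%N%:Z.
  rewrite (horner_mx_sum _ sg) summxE; apply: le_trans (ler_norm_sum _ _ _) _.
  apply: (@le_trans _ _ (\sum_(i < n.+1) (E.+1 * T)%N%:Z)); last first.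
    by rewrite sumr_const card_ord -mulr_natl natz -PoszM mulnA.
  apply: ler_sum => i _; rewrite mxE normrM mulnC PoszM ler_pM //.
  rewrite -abszE lez_nat leqW // /E; apply: leq_trans (leq_bigmax i).
  by apply: leq_trans (leq_bigmax k); apply: (leq_bigmax l).
rewrite -lez_nat abszE; apply: le_trans (ler_norm_sum _ _ _) _.
apply: (@le_trans _ _ (\sum_(s : 'S_n.+1) ((n.+1 * E.+1 * T) ^ n.+1)%N%:Z)); last first.
  by rewrite sumr_const card_Sn -mulr_natl natz -PoszM expnMn mulnA.
apply: ler_sum => s _; rewrite normrM normrX normrN1 expr1n mul1r normr_prod.
apply: (@le_trans _ _ (\prod_(i < n.+1) (n.+1 * E.+1 * T)%N%:Z)).
  by apply: ler_prod => i _; rewrite normr_ge0 entry.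
by rewrite prodr_const card_ord ler_expz_nat.
Qed.

Lemma horner_mx_eigen (R : comNzRingType) n (A : 'M[R]_n.+1) (v : 'cV[R]_n.+1) c (p : {poly R}) :
  A *m v = c *: v -> horner_mx A p *m v = p.[c] *: v.
Proof.
move=> Av; elim/poly_ind: p => [|p b IHp]; first by rewrite rmorph0 mul0mx horner0 scale0r.
rewrite rmorphD rmorphM /= horner_mx_X horner_mx_C mulmxDl -mulmxA Av -scalemxAr IHp.
by rewrite mul_scalar_mx scalerA hornerMXaddC scalerDl [c * _]mulrC.
Qed.

(** Taking [q] out of the first [k] columns writes [M] as an integer matrix times a diagonal one of
    determinant [q ^ k]. *)
Lemma dvdz_exp_det (q : int) n (M : 'M[int]_n) (k : nat) : (k <= n)%N ->
  (forall i j : 'I_n, (j < k)%N -> (q %| M i j)%Z) -> (q ^+ k %| \det M)%Z.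
Proof.
move=> kn qM; pose D : 'rV[int]_n := \row_j (if (j < k)%N then q else 1).
have -> : M = (\matrix_(i, j) if (j < k)%N then (M i j %/ q)%Z else M i j) *m diag_mx D.
  apply/matrixP => i j; rewrite mul_mx_diag !mxE; case: ltnP => [jk|_]; last by rewrite mulr1.
  by rewrite divzK ?qM.
rewrite det_mulmx det_diag dvdz_mull //.
under eq_bigr => i _ do rewrite mxE.
rewrite -big_mkcond /= prodr_const.
suff -> : #|[pred i : 'I_n | (i < k)%N]| = k by [].
by rewrite -sum1_card /= -(big_ord_widen n (fun => 1%N) kn) sum1_card card_ord.
Qed.

Lemma intr_Fp_eq0 (p : nat) (z : int) : prime p -> (z%:~R == 0 :> 'F_p) = (p %| z)%Z.
Proof. by move=> p_pr; rewrite (dvdz_pcharf (pchar_Fp p_pr)). Qed.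

(** Every row but the last shifts [r ^ i] to [r ^ i.+1]; the last row expresses [f(r) = 0]. *)
Lemma scaled_companion_eigen (F : comNzRingType) (f : {poly int}) n (r : F) :
  size f = n.+2 -> (map_poly intr f).[r] = 0 ->
  map_mx intr (scaled_companion f n) *m (\col_(i < n.+1) r ^+ i) =
    ((lead_coef f)%:~R * r) *: (\col_(i < n.+1) r ^+ i).
Proof.
move=> sf fr; apply/colP => i; rewrite !mxE.
have [ein | ltin] := eqVneq (i : nat) n.
  rewrite [X in _ ^+ X]ein.
  move: fr; rewrite (horner_coef_wide (n := n.+2)); last by rewrite -sf size_poly.
  rewrite big_ord_recr /= [(map_poly _ _)`_n.+1]coef_map_id0 //.
  move/eqP; rewrite addrC addr_eq0 => /eqP; rewrite -{1}[n.+1]/n.+2.-1 -mulrA -exprS.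
  have -> : f`_n.+1 = lead_coef f by rewrite lead_coefE sf.
  move=> ->; rewrite -sumrN; apply: eq_bigr => j _.
  by rewrite !mxE ein eqxx coef_map_id0 // rmorphN mulNr.
have iS : (i.+1 < n.+1)%N by rewrite ltn_neqAle ltn_ord andbT eqSS.
rewrite (bigD1 (Ordinal iS)) //= big1 => [|j /negPf ji].
  by rewrite addr0 !mxE (negPf ltin) eqxx exprS mulrA.
rewrite !mxE (negPf ltin); case: eqP => [ij|_]; last by rewrite rmorph0 mul0r.
by case/eqP: ji; apply/val_inj.
Qed.

(* Multiplying on the right by a Vandermonde matrix, invertible mod [p], whose
   first columns are the eigenvectors attached to [rs], makes these columns
   divisible by [p]. *)
Lemma dvdn_exp_det_horner (f g : {poly int}) n p (rs : seq nat) :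
  prime p -> size f = n.+2 -> (n < p)%N -> ~~ (p %| lead_coef f)%Z ->
  uniq rs -> (size rs <= n.+1)%N ->
  {in rs, forall r, [&& r < p, (p %| f.[r%:Z])%Z & (p %| g.[lead_coef f * r%:Z])%Z]%N} ->
  (p ^ size rs %| `|\det (horner_mx (scaled_companion f n) g)|)%N.
Proof.
move=> p_pr sf np pa urs srs rsP.
(* The roots are completed by the other residues mod [p], at least [n.+1] in all because [n < p], to
   get distinct nodes for a square Vandermonde matrix. *)
pose s := rs ++ [seq r <- iota 0 p | r \notin rs].
have us : uniq s.
  rewrite cat_uniq urs filter_uniq ?iota_uniq // andbT.
  by apply/hasPn => r; rewrite mem_filter => /andP[].
have sp : {in s, forall r, (r < p)%N}.
  move=> r; rewrite mem_cat mem_filter mem_iota => /orP[/rsP/and3P[]//|].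
  by case/and3P.
have ss : (n.+1 <= size s)%N.
  apply: leq_trans np _; rewrite -{1}(size_iota 0 p); apply: uniq_leq_size (iota_uniq _ _) _.
  by move=> r; rewrite mem_cat mem_filter; case: (r \in rs).
pose V : 'M[int]_n.+1 := Vandermonde n.+1 (\row_j (nth 0%N s j)%:Z).
pose H := horner_mx (scaled_companion f n) g.
have colV j : map_mx intr (col j V) = \col_(i < n.+1) ((nth 0%N s j)%:Z%:~R : 'F_p) ^+ i.
  by apply/colP => i; rewrite !mxE rmorphXn.
(* Modulo [p], the column of [H V] at a root [r] in [rs] is [g(a r)] times an eigenvector, with [a]
   the leading coefficient of [f], hence zero. *)
have dHV : ((p%:Z ^+ size rs) %| \det (H *m V))%Z.
  apply: dvdz_exp_det => // i j jk; rewrite -intr_Fp_eq0 //.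
  set r := nth 0%N s j; have rrs : r \in rs by rewrite /r nth_cat jk mem_nth.
  have /and3P[_ fr gr] := rsP r rrs.
  have fr0 : (map_poly intr f : {poly 'F_p}).[r%:Z%:~R] = 0.
    by rewrite horner_map; apply/eqP; rewrite intr_Fp_eq0.
  have := horner_mx_eigen (map_poly intr g) (scaled_companion_eigen sf fr0).
  rewrite -rmorphM horner_map /=.
  have /eqP -> : g.[lead_coef f * r%:Z]%:~R == 0 :> 'F_p by rewrite intr_Fp_eq0.
  rewrite scale0r -map_horner_mx -/H -colV -map_mxM => /colP /(_ i).
  rewrite [LHS]mxE [RHS]mxE [X in X%:~R = _]mxE => E.
  rewrite [(H *m V) i j]mxE -E; apply/eqP; congr (_%:~R).
  by apply: eq_bigr => k _; rewrite [col _ _ _ _]mxE.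
have dV : ~~ (p %| \det V)%Z.
  rewrite det_Vandermonde -intr_Fp_eq0 // rmorph_prod; apply/prodf_neq0 => i _.
  rewrite rmorph_prod; apply/prodf_neq0 => j ij; rewrite !mxE intr_Fp_eq0 //.
  have lt k : (k < n.+1)%N -> (nth 0%N s k < p)%N.
    by move=> kn; apply/sp/mem_nth/leq_trans/ss.
  have := lt i (ltn_ord i); have := lt j (ltn_ord j).
  have : nth 0%N s i != nth 0%N s j.
    by rewrite nth_uniq ?(leq_trans (ltn_ord _)) // neq_ltn ij.
  move: (nth _ _ i) (nth _ _ j) => x y xy yp xp.
  by rewrite dvdzE absz_nat; apply/negP => /dvdn_leq; lia.
have := dHV; rewrite det_mulmx dvdzE abszM abszX absz_nat Gauss_dvdl //.
by rewrite coprimeXl // prime_coprime.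
Qed.

(** * Covering F_p by images of boxes *)

(** Differences are allowed because a collision [y = x + z] with [z] in [A] must put [x = y - z] in
    the next set. *)
Definition spread (V : finZmodType) (A : {set V}) (j : nat) : {set V} :=
  iter j (fun S : {set V} => [set x + y | x in S, y in A] :|: [set x - y | x in S, y in A]) [set 0].

Lemma mem_spreadD (V : finZmodType) (A : {set V}) j x y :
  x \in spread A j -> y \in A -> x + y \in spread A j.+1.
Proof. by move=> xS yA; rewrite inE; apply/orP; left; apply/imset2P; exists x y. Qed.

Lemma mem_spreadB (V : finZmodType) (A : {set V}) j x y :
  x \in spread A j -> y \in A -> x - y \in spread A j.+1.
Proof. by move=> xS yA; rewrite inE; apply/orP; right; apply/imset2P; exists x y. Qed.

(* If [x] is new at step [3 i + 2] then [x + A] is disjoint from step [3 i] and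
   contained in step [3 i + 3], so three steps gain [#|A|] elements. *)
Lemma spread_full p (A : {set 'F_p}) n :
  0 \in A -> 1 \in A -> (#|'F_p| < #|A| * n)%N -> spread A (3 * n) = [set: 'F_p].
Proof.
move=> A0 A1 pA.
have subS j : spread A j \subset spread A j.+1.
  by apply/subsetP => x xS; rewrite -[x]addr0 mem_spreadD.
have S0 j : 0 \in spread A j.
  by elim: j => [|j IHj]; [rewrite inE | apply: (subsetP (subS j))].
(* A step that adds nothing leaves a set containing [0] and closed under adding [1], which is all of
   [F_p]. *)
have stable j : spread A j.+1 \subset spread A j -> spread A j = setT.
  move=> sj; apply/setP => x; rewrite inE -[x]natr_Zp.
  elim: (x : nat) => [|k IHk]; first exact: S0.
  by rewrite -natr1; apply: (subsetP sj); apply: mem_spreadD.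
have full j : spread A j = setT -> spread A j.+1 = setT.
  by move=> Sj; apply/eqP; rewrite eqEsubset subsetT -Sj subS.
have grow i : spread A (3 * i) = setT \/ (#|A| * i <= #|spread A (3 * i)|)%N.
  elim: i => [|i [IHi|IHi]]; first by right; rewrite muln0.
    by left; rewrite mulnS !addSn add0n; apply/full/full/full.
  have [/stable Sj|] := boolP (spread A (3 * i).+2 \subset spread A (3 * i).+1).
    by left; rewrite mulnS !addSn add0n; apply/full/full.
  case/subsetPn => x x2 x1; right.
  have -> : (3 * i.+1)%N = (3 * i).+3 by rewrite mulnS.
  rewrite mulnS -{1}(card_imset [in A] (addrI x)) addnC.
  apply: leq_trans (leq_add IHi (leqnn _)) _.
  have [|dis] := boolP [disjoint spread A (3 * i) & [set x + y | y in A]].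
    rewrite -leq_card_setU => /eqP <-; apply: subset_leq_card.
    have SS : spread A (3 * i) \subset spread A (3 * i).+3.
      exact: subset_trans (subset_trans (subS _) (subS _)) (subS _).
    apply/subsetP => z /setUP[/(subsetP SS) //|/imsetP[y yA ->]].
    exact: mem_spreadD.
  move: dis; rewrite -setI_eq0 => /set0Pn[y]; rewrite inE => /andP[yS /imsetP[z zA yE]].
  by case/negP: x1; rewrite -[x](addrK z) -yE mem_spreadB.
have [//|] := grow n; rewrite leqNgt => /negP[].
by apply: leq_ltn_trans pA; apply: max_card.
Qed.

Section LinearForm.
Variables (p n : nat) (w : 'I_n.+1 -> 'F_p).

Definition int_form (c : 'I_n.+1 -> int) : 'F_p := \sum_i (c i)%:~R * w i.

Lemma int_formD (b c : 'I_n.+1 -> int) :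
  int_form (fun i => b i + c i) = int_form b + int_form c.
Proof. by rewrite -big_split; apply: eq_bigr => i _; rewrite rmorphD mulrDl. Qed.

Lemma int_formB (b c : 'I_n.+1 -> int) :
  int_form (fun i => b i - c i) = int_form b - int_form c.
Proof. by rewrite -sumrB; apply: eq_bigr => i _; rewrite rmorphB mulrBl. Qed.

(** Points of the box [[0, m] ^ n.+1] differ by vectors with entries at most [m] in absolute value,
    so the form is injective there and its image [A] has [m.+1 ^ n.+1] elements. Then [3 N] steps of
    [spread] fill [F_p]. *)
Lemma int_form_cover (m N : nat) :
  prime p -> w ord0 = 1 -> (0 < m)%N ->
  (forall c : 'I_n.+1 -> int, (forall i, `|c i| <= m%:Z) -> int_form c = 0 -> forall i, c i = 0) ->
  (p < m.+1 ^ n.+1 * N)%N ->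
  forall x, exists2 b : 'I_n.+1 -> nat, (forall i, b i <= 6 * N * m)%N & int_form (fun i => b i) = x.
Proof.
move=> p_pr w0 m0 inj pm.
pose phi (b : {ffun 'I_n.+1 -> 'I_m.+1}) := int_form (fun i => (b i : nat)).
pose A := [set phi b | b : {ffun 'I_n.+1 -> 'I_m.+1}].
have cA : #|A| = (m.+1 ^ n.+1)%N.
  rewrite card_imset ?card_ffun ?card_ord // => b c bc; apply/ffunP => i; apply/val_inj.
  have := inj (fun i => (b i : nat)%:Z - (c i : nat)%:Z); rewrite int_formB -/(phi b) -/(phi c) bc subrr.
  move=> /(_ _ erefl i); rewrite /= => H; have {}H := H _; apply/eqP.
  rewrite -eqz_nat -subr_eq0 H // => j.
  by have := ltn_ord (b j); have := ltn_ord (c j); move: (nat_of_ord (b j)) (nat_of_ord (c j)) => x y; lia.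
have A0 : 0 \in A.
  by apply/imsetP; exists [ffun=> ord0] => //; rewrite /phi /int_form big1 // => i _; rewrite ffunE mul0r.
have A1 : 1 \in A.
  apply/imsetP; exists [ffun i => if i == ord0 then inord 1 else ord0] => //.
  rewrite /phi /int_form (bigD1 ord0) //= ffunE eqxx inordK // mul1r w0 big1 ?addr0 // => i i0.
  by rewrite ffunE (negPf i0) mul0r.
have spreadP j x : x \in spread A j ->
    exists2 c : 'I_n.+1 -> int, forall i, `|c i| <= (j * m)%N%:Z & int_form c = x.
  elim: j x => [|j IHj] x.
    rewrite inE => /eqP ->; exists (fun=> 0) => [i|]; first by rewrite normr0.
    by rewrite /int_form big1 // => i _; rewrite mul0r.
  rewrite inE => /orP[] /imset2P[y z /IHj[c cj <-] /imsetP[b _ ->] ->].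
    exists (fun i => c i + (b i : nat)%:Z) => [i|]; last by rewrite int_formD.
    by have := cj i; have := ltn_ord (b i); move: (nat_of_ord (b i)) (c i) => u v; lia.
  exists (fun i => c i - (b i : nat)%:Z) => [i|]; last by rewrite int_formB.
  by have := cj i; have := ltn_ord (b i); move: (nat_of_ord (b i)) (c i) => u v; lia.
have full : spread A (3 * N) = setT by apply: spread_full; rewrite // cA card_Fp.
(* Subtracting the value at the constant vector [3 N m] and adding that vector back moves the
   coefficients from [[-3 N m, 3 N m]] to [[0, 6 N m]]. *)
move=> x; have := in_setT (x - int_form (fun=> (3 * N * m)%N%:Z)); rewrite -full.
case/spreadP => c cN cx; exists (fun i => absz (c i + (3 * N * m)%N%:Z)) => [i|].
  by have := cN i; lia.
rewrite -[RHS](subrK (int_form (fun=> (3 * N * m)%N%:Z))) -cx -int_formD.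
by apply: eq_bigr => i _; congr (_%:~R * _); have := cN i; lia.
Qed.

(* Translating a point of the box of side [T - M] by the preimage, in the box of
   side [M], of the opposite of its value is injective for a fixed value. *)
Lemma card_int_form_zeros (M T : nat) : prime p ->
  (forall x, exists2 b : 'I_n.+1 -> nat, (forall i, b i <= M)%N & int_form (fun i => b i) = x) ->
  ((T - M) ^ n.+1 <= p * #|[set b : {ffun 'I_n.+1 -> 'I_T} | int_form (fun i => (b i).+1) == 0%R]|)%N.
Proof.
move=> p_pr cover; case: T => [|T]; first by rewrite exp0n.
have [TM|MT] := leqP T.+1 M; first by move: TM; rewrite -subn_eq0 => /eqP ->; rewrite exp0n.
have {}cover x : exists b : {ffun 'I_n.+1 -> 'I_M.+1}, int_form (fun i => (b i : nat)) == x.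
  have [b bM bx] := cover x; exists [ffun i => inord (b i)]; rewrite -bx; apply/eqP.
  by apply: eq_bigr => i _; rewrite ffunE inordK // ltnS.
pose B x := xchoose (cover x).
have BP x : int_form (fun i => (B x i : nat)) = x by apply/eqP/(xchooseP (cover x)).
pose s (b : {ffun 'I_n.+1 -> 'I_(T.+1 - M)}) := int_form (fun i => (b i).+1).
(* Keeping the value [s b] next to the translated point allows [b] to be recovered; the image of [F]
   lies in [F_p] times the zero set. *)
pose F b := (s b, [ffun i => inord (b i + B (- s b) i)] : {ffun 'I_n.+1 -> 'I_T.+1}).
have ltF (b : {ffun 'I_n.+1 -> 'I_(T.+1 - M)}) i : (b i + B (- s b) i < T.+1)%N.
  by have := ltn_ord (b i); have := ltn_ord (B (- s b) i); lia.
have F_inj : injective F.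
  move=> b c [] bc /ffunP H; apply/ffunP => i; apply/val_inj/eqP.
  have := congr1 val (H i); rewrite !ffunE /= !inordK // bc => /eqP.
  by rewrite eqn_add2r.
have -> : ((T.+1 - M) ^ n.+1)%N = #|[set F b | b : {ffun 'I_n.+1 -> 'I_(T.+1 - M)}]|.
  by rewrite card_imset // card_ffun !card_ord.
rewrite -[leqRHS](congr1 (muln^~ _) (card_Fp p_pr)) -cardsT -cardsX; apply: subset_leq_card.
apply/subsetP => _ /imsetP[b _ ->]; rewrite !inE /=.
rewrite -[X in _ == X](subrr (s b)) -[X in _ == _ + X](BP (- s b)) -int_formD; apply/eqP.
by apply: eq_bigr => i _; rewrite ffunE inordK // addSn PoszD.
Qed.
End LinearForm.

(** * Chebyshev bounds *)

Lemma prod_prime_powers_dvd (m n N : nat) (e : nat -> nat) :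
  (forall p, m <= p < n -> prime p -> p ^ e p %| N)%N ->
  (\prod_(m <= p < n | prime p) p ^ e p %| N)%N.
Proof.
elim: n => [|n IHn] pN; first by rewrite big_geq.
have [mn|nm] := leqP m n; last by rewrite big_geq.
rewrite big_mkcond big_nat_recr //= -big_mkcond /=.
have {}IHn := IHn (fun p mpn => pN p (ltac:(lia))).
case: ifP => n_pr; last by rewrite ?muln1.
rewrite Gauss_dvd ?IHn ?pN ?mn ?leqnn // big_nat_cond.
apply: (big_ind (fun q => coprime q (n ^ e n))) => [|a b|p].
- exact: coprime1n.
- by rewrite coprimeMl => -> ->.
- case/andP => /andP[_ pn] p_pr; rewrite coprimeXl // coprimeXr // coprime_sym prime_coprime //.
  by rewrite gtnNdvd // prime_gt0.
Qed.

Lemma prod_primes_dvd (m n N : nat) :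
  (forall p, m <= p < n -> prime p -> p %| N)%N ->
  (\prod_(m <= p < n | prime p) p %| N)%N.
Proof. by move=> pN; have := @prod_prime_powers_dvd m n N (fun=> 1%N) pN. Qed.

(** This coefficient occurs twice in the expansion of [(1 + 1) ^ (2 m + 1)], at [m] and at
    [m + 1]. *)
Lemma bin_double_le m : ('C(m.*2.+1, m) <= 4 ^ m)%N.
Proof.
rewrite -(leq_pmul2l (ltn0Sn 1)); have -> : (2 * 4 ^ m = 2 ^ m.*2.+1)%N.
  by rewrite expnS -mul2n expnM.
have := expnDn 1 1 m.*2.+1.
rewrite addn1 => ->; under eq_bigr => i _ do rewrite !exp1n !muln1.
have m1 : (m < m.*2.+2)%N by lia.
have m2 : (m.+1 < m.*2.+2)%N by lia.
rewrite (bigD1 (Ordinal m1)) //= (bigD1 (Ordinal m2)) //=; last by rewrite -val_eqE /= ; lia.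
rewrite -[in X in (_ <= _ + (X + _))%N]bin_sub ?leq_addl; last by lia.
have -> : (m.*2.+1 - m.+1 = m)%N by lia.
by rewrite addnA mul2n -addnn leq_addr.
Qed.

(** Erdos's induction: an even [n > 2] is not prime; for [n = 2 m + 1] the primes in [(m + 1, n]]
    divide ['C(n, m) <= 4 ^ m], and the others are covered by the bound at [m + 1]. *)
Lemma primorial_le n : (\prod_(0 <= p < n.+1 | prime p) p <= 4 ^ n)%N.
Proof.
elim/ltn_ind: n => n IHn.
have [n2|n2] := ltnP n 3.
  by case: n n2 {IHn} => [|[|[|]]] // _; rewrite /index_iota unlock.
have [n_odd|n_even] := boolP (odd n); last first.
  rewrite big_mkcond big_nat_recr //= -big_mkcond /= ifF; last first.
    by apply/negbTE; apply: contra n_even => /even_prime[?|//]; lia.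
  case: n => // n in IHn n2 n_even *; rewrite ?muln1.
  by apply: leq_trans (IHn n (leqnn _)) _; rewrite leq_exp2l.
pose m := n./2; have nE : n = m.*2.+1 by rewrite -[LHS]odd_double_half n_odd.
have m1 : (m.+2 <= n.+1)%N by lia.
rewrite (@big_cat_nat _ _ _ m.+2) //=.
have -> : (4 ^ n = 4 ^ m.+1 * 4 ^ m)%N by rewrite -expnD; congr expn; lia.
apply: leq_mul; first by apply: IHn; lia.
apply: leq_trans (bin_double_le m); apply: dvdn_leq; first by rewrite bin_gt0; lia.
apply: prod_primes_dvd => p /andP[mp pn] p_pr.
have := bin_fact (_ : m <= m.*2.+1)%N; rewrite -nE => /(_ (ltac:(lia))) fE.
have : (p %| n`!)%N by rewrite dvdn_fact // prime_gt0 //; lia.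
have notf k : (k < p)%N -> ~~ (p %| k`!)%N.
  elim: k => [|k IHk] kp; first by rewrite dvdn1; apply: contraTneq p_pr => ->.
  by rewrite factS Euclid_dvdM // negb_or IHk 1?ltnW // gtnNdvd.
rewrite -fE !Euclid_dvdM // (negPf (notf m _)) ?(negPf (notf (n - m)%N _)) ?orbF //; lia.
Qed.

Lemma nat_sqrt_exists x : exists y, (y * y <= x < y.+1 * y.+1)%N.
Proof.
elim: x => [|x [y /andP[yx xy]]]; first by exists 0%N.
by case: (ltnP x.+1 (y.+1 * y.+1)) => h; [exists y | exists y.+1]; nia.
Qed.

Section Chebyshev.
Variable R : realType.

Lemma ln_natM_prod (I : Type) (s : seq I) (P : pred I) (F : I -> nat) :
  (forall i, P i -> (0 < F i)%N) ->
  ln ((\prod_(i <- s | P i) F i)%N%:R : R) = \sum_(i <- s | P i) ln ((F i)%:R : R).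
Proof.
move=> F0; elim: s => [|a s IHs]; first by rewrite !big_nil ln1.
rewrite !big_cons; case: ifP => // Pa; rewrite natrM lnM ?IHs // posrE ltr0n ?F0 //.
by rewrite prodn_cond_gt0.
Qed.

Lemma ler_ln_nat (m n : nat) : (0 < m)%N -> (m <= n)%N -> ln (m%:R : R) <= ln n%:R.
Proof. by move=> m0 mn; rewrite ler_ln ?ler_nat // posrE ltr0n // (leq_trans m0). Qed.

Lemma ln_nat_ge0 (n : nat) : 0 <= ln (n%:R : R).
Proof. by case: n => [|n]; [rewrite ln0 | rewrite ln_ge0 // ler1n]. Qed.

Lemma ln_nat_le (n : nat) : ln (n%:R : R) <= n%:R.
Proof.
case: n => [|n]; first by rewrite ln0.
by apply/ltW/ln_sublinear; rewrite ltr0n.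
Qed.

Lemma sum_ln_primes_le (x : nat) :
  \sum_(0 <= p < x.+1 | prime p) ln (p%:R : R) <= x%:R * ln 4%:R.
Proof.
rewrite -ln_natM_prod => [|p]; last exact: prime_gt0.
rewrite mulr_natl -lnXn ?ltr0n // -natrX; apply: ler_ln_nat; last exact: primorial_le.
by rewrite prodn_cond_gt0 // => p; apply: prime_gt0.
Qed.

(** A prime above [sqrt x] has [ln x <= 2 ln p]. The others number at most [y], the integer square
    root, and cost [y ln x <= 2 y ^ 2 <= 2 x]. *)
Lemma prime_count_le (x : nat) :
  \sum_(0 <= p < x.+1 | prime p) ln (x%:R : R) <= (2 * ln 4%:R + 2) * x%:R.
Proof.
have [->|x0] := posnP x; first by rewrite ln0 // big1 // mulr0.
have [y /andP[yx xy]] := nat_sqrt_exists x.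
have lnxy : ln x%:R <= 2 * y%:R :> R.
  apply: (@le_trans _ _ (ln (y.+1 * y.+1)%N%:R)); first by apply: ler_ln_nat => //; exact: ltnW.
  rewrite natrM lnM ?posrE ?ltr0n // -mulr2n mulr_natl lerMn2r /=.
  by rewrite -natr1 addrC le_ln1Dx // (lt_le_trans (ltrN10 R)).
apply: (@le_trans _ _ (\sum_(0 <= p < x.+1 | prime p) (2 * ln p%:R + (p * p <= x)%:R * ln x%:R))).
  apply: ler_sum => p p_pr; have [px|px] := leqP (p * p)%N x.
    by rewrite mul1r lerDr mulr_ge0 // ln_nat_ge0.
  rewrite mul0r addr0 mulr_natl mulr2n -lnM ?posrE ?ltr0n ?prime_gt0 // -natrM.
  by apply: ler_ln_nat => //; exact: ltnW.
rewrite big_split /= -mulr_sumr [leRHS]mulrDl; apply: lerD.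
  by rewrite -mulrA ler_pM2l // mulrC sum_ln_primes_le.
apply: (@le_trans _ _ (y%:R * ln x%:R)).
  rewrite -mulr_suml ler_wpM2r ?ln_nat_ge0 // -natr_sum ler_nat.
  have cnt n : (\sum_(0 <= p < n.+1) (0 < p <= y) <= minn y n)%N.
    by elim: n => [|n IHn]; [rewrite big_nat1 | rewrite big_nat_recr //=; lia].
  apply: leq_trans (leq_trans (cnt x) (geq_minl _ _)).
  rewrite big_mkcond /=; apply: leq_sum => p _; case: ifP => // /prime_gt0 p0.
  have [px|//] := leqP (p * p)%N x.
  by rewrite p0 (_ : (p <= y)%N = true) //; nia.
apply: (@le_trans _ _ (y%:R * (2 * y%:R))); first by rewrite ler_wpM2l.
by rewrite mulrCA ler_pM2l // -natrM ler_nat.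
Qed.
End Chebyshev.

(** * Mertens upper bound for roots modulo primes *)

Definition roots_mod (f : {poly int}) (p : nat) : seq nat :=
  [seq r <- iota 0 p | (p %| f.[r%:Z])%Z].

Lemma size_roots_mod (f : {poly int}) d p :
  prime p -> size f = d.+1 -> ~~ (p %| lead_coef f)%Z -> (size (roots_mod f p) <= d)%N.
Proof.
move=> p_pr sf pa; pose fp : {poly 'F_p} := map_poly intr f.
have fp0 : fp != 0.
  apply: contra pa => /eqP fp0; rewrite -intr_Fp_eq0 // lead_coefE -coef_map_id0 // -/fp fp0.
  by rewrite coef0.
rewrite -ltnS -sf -(size_map (fun r : nat => r%:R : 'F_p)).
have sfp : (size fp <= size f)%N.
  by apply/leq_sizeP => i fi; rewrite coef_map_id0 // nth_default.
apply: leq_trans sfp; apply: max_poly_roots => //.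
  apply/allP => x /mapP[r rP xr]; move: rP; rewrite mem_filter => /andP[pr _]; rewrite {x}xr.
  by rewrite rootE /fp pmulrn horner_map /= intr_Fp_eq0.
rewrite map_inj_in_uniq ?filter_uniq ?iota_uniq // => r s.
rewrite !mem_filter !mem_iota => /and3P[_ _ rp] /and3P[_ _ sp].
by move/(congr1 val); rewrite /= !val_Fp_nat // !modn_small.
Qed.

(** The vector [c] stands for the algebraic number [sum c_i (a theta) ^ i], where [a] is the leading
    coefficient of [f]. *)
Definition coef_poly_ord (n : nat) (c : 'I_n.+1 -> int) : {poly int} := \poly_(i < n.+1) c (inord i).

Lemma coef_coef_poly_ord n (c : 'I_n.+1 -> int) (i : 'I_n.+1) : (coef_poly_ord c)`_i = c i.
Proof. by rewrite coef_poly ltn_ord inord_val. Qed.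

Lemma int_form_horner p n (c : 'I_n.+1 -> int) (x : int) :
  int_form (fun i : 'I_n.+1 => x%:~R ^+ i : 'F_p) c = ((coef_poly_ord c).[x])%:~R.
Proof.
rewrite horner_poly rmorph_sum; apply: eq_bigr => i _.
by rewrite inord_val rmorphM rmorphXn.
Qed.

Lemma nat_root_exists C k x : (0 < C < x)%N -> (0 < k)%N ->
  exists2 m, (0 < m)%N & (C * m ^ k < x <= C * m.+1 ^ k)%N.
Proof.
move=> /andP[C0]; case: k => // k; elim: x => // x IHx; rewrite ltnS leq_eqVlt => /orP[/eqP <-|Cx] _.
  exists 1%N => //; rewrite exp1n muln1 leqnn /= -addn1 expnS.
  have : (0 < 2 ^ k)%N by rewrite expn_gt0.
  nia.
have [//|m m0 /andP[mx xm]] := IHx Cx.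
have [xm'|xm'] := leqP x.+1 (C * m.+1 ^ k.+1).
  by exists m => //; rewrite xm' andbT ltnW // ltnS.
exists m.+1 => //; rewrite xm' /=; apply: leq_ltn_trans xm _.
by rewrite ltn_pmul2l // ltn_exp2r.
Qed.

(** Evaluation at [a r] mod [p], with [a] the leading coefficient, is the form with weights
    [(a r) ^ i]. A kernel vector with entries at most [m] has norm divisible by [p] but at most
    [C * m ^ n.+1 < p], so it vanishes and the covering and counting lemmas apply. *)
Lemma card_box_zeros (f : {poly int}) n :
  irreducible_poly (map_poly intr f : {poly rat}) -> size f = n.+2 ->
  exists p0 K : nat, (0 < K)%N /\ forall p r X T, prime p -> (p0 < p)%N -> r \in roots_mod f p ->
    (p <= X ^ n.+1)%N ->
    ((T - K * X) ^ n.+1 <= p * #|[set b : {ffun 'I_n.+1 -> 'I_T} |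
       (p %| (coef_poly_ord (fun i => (b i).+1)).[lead_coef f * r%:Z])%Z]|)%N.
Proof.
move=> f_irr sf; pose A := scaled_companion f n.
have [C C0 detC] := det_horner_mx_le A.
exists (n + `|lead_coef f| + C)%N, (6 * C.+1)%N; split=> // p r X T p_pr p0 rP pX.
have np : (n < p)%N by lia.
have a0 : lead_coef f != 0 by rewrite lead_coef_eq0 -size_poly_eq0 sf.
have pa : ~~ (p %| lead_coef f)%Z.
  by rewrite dvdzE absz_nat; apply/negP => /dvdn_leq; rewrite absz_gt0 => /(_ a0); lia.
(* The maximality of [m] gives [p <= C * m.+1 ^ n.+1], so [N = C.+1] is admissible in
   [int_form_cover]. *)
have [||m m0 /andP[Cm pm]] := @nat_root_exists C n.+1 p; [lia | by [] |].
pose w (i : 'I_n.+1) : 'F_p := (lead_coef f * r%:Z)%:~R ^+ i.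
have small (c : 'I_n.+1 -> int) : (forall i, `|c i| <= m%:Z) -> int_form w c = 0 -> forall i, c i = 0.
  move=> cm; rewrite int_form_horner => /eqP; rewrite intr_Fp_eq0 // => pg i.
  pose g := coef_poly_ord c; rewrite -coef_coef_poly_ord -/g.
  have [->|g0] := eqVneq g 0; first by rewrite coef0.
  have sg : (size g <= n.+1)%N by apply: size_poly.
  have := det_horner_companion_neq0 f_irr sf g0 sg; rewrite -absz_gt0 => d0.
  have pd : (p <= `|\det (horner_mx A g)|)%N.
    rewrite dvdn_leq // -[p in (p %| _)%N]expn1.
    apply: (dvdn_exp_det_horner (rs := [:: r])) => // s; rewrite inE => /eqP ->; rewrite pg andbT.
    by move: rP; rewrite mem_filter mem_iota => /and3P[-> _ ->].
  have /(leq_trans pd) : (`|\det (horner_mx A g)| <= C * m ^ n.+1)%N.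
    apply: detC => // j; rewrite coef_poly; case: ifP => // _; exact: cm.
  by rewrite leqNgt Cm.
have cover := @int_form_cover p n w m C.+1 p_pr erefl m0 small.
have mX : (m <= X)%N.
  rewrite -(@leq_exp2r _ _ n.+1) //; apply: leq_trans pX; apply: leq_trans (ltnW Cm).
  by rewrite leq_pmull.
have p1 : (p < m.+1 ^ n.+1 * C.+1)%N.
  apply: leq_ltn_trans pm _; rewrite mulnC ltn_pmul2l // expn_gt0 //.
have H := @card_int_form_zeros p n w (6 * C.+1 * m)%N T p_pr (cover p1).
apply: (@leq_trans ((T - 6 * C.+1 * m) ^ n.+1)).
  by rewrite leq_exp2r // leq_sub2l // leq_mul2l mX orbT.
apply: leq_trans H _; rewrite leq_mul2l; apply/orP; right; apply: eq_leq; apply: eq_card => b.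
by rewrite !inE int_form_horner intr_Fp_eq0.
Qed.

Section Mertens.
Variable R : realType.

Lemma sum_ln_prime_powers_le (m n N : nat) (e : nat -> nat) : (0 < N)%N ->
  (forall p, m <= p < n -> prime p -> p ^ e p %| N)%N ->
  \sum_(m <= p < n | prime p) (e p)%:R * ln (p%:R : R) <= ln N%:R.
Proof.
move=> N0 pN.
have pos p : prime p -> (0 < p ^ e p)%N by move=> p_pr; rewrite expn_gt0 prime_gt0.
have -> : \sum_(m <= p < n | prime p) (e p)%:R * ln (p%:R : R) =
    \sum_(m <= p < n | prime p) ln ((p ^ e p)%N%:R : R).
  apply: eq_bigr => p p_pr; rewrite natrX lnXn ?ltr0n ?prime_gt0 //.
  by rewrite mulr_natl.
rewrite -ln_natM_prod //; apply: ler_ln_nat; first exact: prodn_cond_gt0.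
by apply: dvdn_leq => //; apply: prod_prime_powers_dvd.
Qed.

(** Double counting: for each [b], the number of roots [r] mod [p] with [p] dividing its value at
    [a r] is at most the exponent of [p] in the norm [D b]. Summing over [p] gives at most
    [ln (D b)], and there are [T ^ n.+1] points [b]. *)
Lemma sum_box_zeros_le (f : {poly int}) n :
  irreducible_poly (map_poly intr f : {poly rat}) -> size f = n.+2 ->
  exists p0 C : nat, (0 < C)%N /\ forall q x T, (p0 <= q)%N -> (0 < T)%N ->
    \sum_(q.+1 <= p < x.+1 | prime p) (\sum_(r <- roots_mod f p)
      #|[set b : {ffun 'I_n.+1 -> 'I_T} |
         (p %| (coef_poly_ord (fun i => (b i).+1)).[lead_coef f * r%:Z])%Z]|)%N%:R * ln (p%:R : R)
    <= (T ^ n.+1)%N%:R * ln (C * T ^ n.+1)%N%:R.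
Proof.
move=> f_irr sf; pose A := scaled_companion f n.
have [C C0 detC] := det_horner_mx_le A.
exists (n + `|lead_coef f|)%N, C; split=> // q x T q0 T0.
pose g (b : {ffun 'I_n.+1 -> 'I_T}) := coef_poly_ord (fun i => (b i).+1).
pose D b := absz (\det (horner_mx A (g b))).
have sg b : (size (g b) <= n.+1)%N by apply: size_poly.
have D0 b : (0 < D b)%N.
  rewrite absz_gt0; apply: det_horner_companion_neq0 => //.
  by apply/eqP => /(congr1 (fun h : {poly int} => h`_(@ord0 n))); rewrite coef_coef_poly_ord coef0.
have DC b : (D b <= C * T ^ n.+1)%N.
  by apply: detC => // i; rewrite coef_poly; case: ifP => // _; rewrite ger0_norm // lez_nat.
have a0 : lead_coef f != 0 by rewrite lead_coef_eq0 -size_poly_eq0 sf.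
have pa p : (q < p)%N -> ~~ (p %| lead_coef f)%Z.
  by move=> qp; rewrite dvdzE absz_nat; apply/negP => /dvdn_leq; rewrite absz_gt0 => /(_ a0); lia.
apply: (@le_trans _ _ (\sum_b ln (D b)%:R)); last first.
  apply: (@le_trans _ _ (\sum_(b : {ffun 'I_n.+1 -> 'I_T}) ln (C * T ^ n.+1)%N%:R)).
    by apply: ler_sum => b _; apply: ler_ln_nat.
  by rewrite sumr_const card_ffun !card_ord mulr_natl.
pose c (p : nat) b := count (fun r : nat => (p %| (g b).[lead_coef f * r%:Z])%Z) (roots_mod f p).
have -> : \sum_(q.+1 <= p < x.+1 | prime p) (\sum_(r <- roots_mod f p)
      #|[set b : {ffun 'I_n.+1 -> 'I_T} | (p %| (g b).[lead_coef f * r%:Z])%Z]|)%N%:R * ln (p%:R : R)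
   = \sum_b \sum_(q.+1 <= p < x.+1 | prime p) (c p b)%:R * ln (p%:R : R).
  rewrite exchange_big /=; apply: eq_bigr => p _; rewrite -mulr_suml -natr_sum; congr (_%:R * _).
  under eq_bigr => r _ do rewrite -sum1dep_card big_mkcond.
  by rewrite exchange_big; apply: eq_bigr => b _; rewrite /c -sum1_count [RHS]big_mkcond.
apply: ler_sum => b _; apply: sum_ln_prime_powers_le => // p /andP[qp _] p_pr.
rewrite /c -size_filter; apply: dvdn_exp_det_horner => //; first by lia.
- exact: pa.
- by rewrite filter_uniq // filter_uniq // iota_uniq.
- rewrite size_filter; apply: leq_trans (count_size _ _) _.
  by apply: size_roots_mod => //; apply: pa.
- by move=> r; rewrite !mem_filter mem_iota => /andP[-> /andP[-> /andP[_]]] ->.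
Qed.

Lemma bernoulli (t : R) n : 0 <= t <= 1 -> 1 - n%:R * t <= (1 - t) ^+ n.
Proof.
move=> /andP[t0 t1]; elim: n => [|n IHn]; first by rewrite mul0r subr0.
have : (1 - t) * (1 - n%:R * t) <= (1 - t) ^+ n.+1 by rewrite exprS ler_wpM2l // subr_ge0.
have : 0 <= n%:R * t * t by rewrite !mulr_ge0.
rewrite -natr1; move: (_ ^+ _) (n%:R) => u v; nra.
Qed.

Lemma sum_roots_mod_le (f : {poly int}) n :
  irreducible_poly (map_poly intr f : {poly rat}) -> size f = n.+2 ->
  exists p0 : nat, forall eps : R, 0 < eps -> exists C : R, forall q x, (p0 <= q)%N -> (0 < x)%N ->
    \sum_(q.+1 <= p < x.+1 | prime p) (size (roots_mod f p))%:R * (ln (p%:R : R) / p%:R)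
    <= (1 + eps) * (ln x%:R + C).
Proof.
move=> f_irr sf.
have [p1 [K [K0 zeros]]] := card_box_zeros f_irr sf.
have [p2 [C [C0 box]]] := sum_box_zeros_le f_irr sf.
exists (p1 + p2)%N => eps eps0.
(* The margin [K X] leaves the fraction [(1 - 1 / L) ^ n.+1] of a box of side [K L X]; by
   Bernoulli's inequality a large [L] keeps it above [1 / (1 + eps)]. *)
have [L L0 epsL] : exists2 L : nat, (0 < L)%N & 1 <= (1 + eps) * (1 - L%:R^-1 :> R) ^+ n.+1.
  pose L := (Num.truncn ((1 + eps) * n.+1%:R / eps)).+1; exists L => //.
  have LL : (1 + eps) * n.+1%:R / eps < L%:R by apply: truncnS_gt.
  have L1 : 1 <= L%:R :> R by rewrite ler1n.
  have Li0 : 0 < L%:R^-1 :> R by rewrite invr_gt0 ltr0n.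
  have Lt : 0 <= (L%:R^-1 : R) <= 1 by rewrite ltW //= invf_le1 // ltr0n.
  apply: (@le_trans _ _ ((1 + eps) * (1 - n.+1%:R * L%:R^-1))).
    have := LL; rewrite ltr_pdivrMr // => H.
    have {}H : (1 + eps) * n.+1%:R * L%:R^-1 <= eps.
      by rewrite ler_pdivrMr ?ltr0n // [eps * _]mulrC ltW.
    by rewrite mulrBr mulr1 mulrA; lra.
  by rewrite ler_wpM2l ?bernoulli // addr_ge0 // ltW.
exists (ln C%:R + n.+1%:R * ln (K * L)%N%:R + n.+1%:R * ln 2%:R) => q x pq x0.
(* The lower bound makes the zero count valid for all [p <= x]; the upper one keeps the logarithm of
   the norms at [ln x + O(1)]. *)
have [X X0 /andP[xX Xx]] : exists2 X, (0 < X)%N & (x <= X ^ n.+1 <= 2 ^ n.+1 * x)%N.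
  have [x1|x1] := leqP x 1.
    by exists 1%N => //; rewrite exp1n x1 /= muln_gt0 expn_gt0.
  have [//|//|m m0] := @nat_root_exists 1 n.+1 x; rewrite !mul1n => /andP[mx xm].
  exists m.+1 => //; rewrite xm /=.
  apply: (@leq_trans ((2 * m) ^ n.+1)); first by rewrite leq_exp2r //; lia.
  by rewrite expnMn leq_pmul2l ?expn_gt0 // ltnW.
pose T := (K * L * X)%N.
have T0 : (0 < T)%N by rewrite !muln_gt0 K0 L0.
have := box q x T (leq_trans (leq_addl _ _) pq) T0.
set S := (X in X <= _ -> _); set S' := (X in _ -> X <= _) => boxS.
pose t : R := (1 - L%:R^-1) ^+ n.+1.
have TR : 0 < (T ^ n.+1)%N%:R :> R by rewrite ltr0n expn_gt0 T0.
have t0 : 0 <= t by rewrite exprn_ge0 // subr_ge0 invf_le1 ?ltr0n // ler1n.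
have TKX : ((T - K * X) ^ n.+1)%N%:R = (T ^ n.+1)%N%:R * t.
  rewrite !natrX -exprMn; congr (_ ^+ _).
  rewrite natrB; last by rewrite /T mulnAC leq_pmulr.
  by rewrite /T !natrM; field; rewrite pnatr_eq0 -lt0n.
have SS : (T ^ n.+1)%N%:R * t * S' <= S.
  rewrite mulr_sumr /S big_nat_cond [leRHS]big_nat_cond.
  apply: ler_sum => p /andP[/andP[qp px] p_pr].
  have pR : 0 < p%:R :> R by rewrite ltr0n prime_gt0.
  set s := size _; set W := (\sum_(r <- _) _)%N.
  have sW : (s * (T - K * X) ^ n.+1 <= W * p)%N.
    rewrite /s -sum1_size big_distrl /= [(W * p)%N]mulnC big_distrr /= big_seq [leqRHS]big_seq.
    apply: leq_sum => r rP; rewrite mul1n; apply: zeros => //.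
      by apply: leq_ltn_trans qp; apply: leq_trans pq; apply: leq_addr.
    by apply: leq_trans xX; rewrite -ltnS.
  have -> : (T ^ n.+1)%N%:R * t * (s%:R * (ln p%:R / p%:R)) =
     (s%:R * ((T ^ n.+1)%N%:R * t) / p%:R) * ln (p%:R : R) by field; rewrite gt_eqF.
  rewrite ler_wpM2r ?ln_nat_ge0 // ler_pdivrMr // -TKX -!natrM ler_nat //.
have S'0 : 0 <= S'.
  by apply: sumr_ge0 => p _; rewrite mulr_ge0 // divr_ge0 // ln_nat_ge0.
have tS' : t * S' <= ln (C * T ^ n.+1)%N%:R.
  by rewrite -(ler_pM2l TR) mulrA; apply: le_trans SS boxS.
have lnX : n.+1%:R * ln X%:R <= n.+1%:R * ln 2%:R + ln x%:R :> R.
  rewrite !mulr_natl -!lnXn ?ltr0n // -!natrX -lnM ?posrE ?ltr0n ?expn_gt0 // -natrM.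
  by apply: ler_ln_nat; rewrite ?expn_gt0 ?X0.
have lnCT : ln (C * T ^ n.+1)%N%:R = ln (C%:R : R) + n.+1%:R * ln (K * L)%N%:R + n.+1%:R * ln X%:R :> R.
  rewrite natrM lnM ?posrE ?ltr0n ?expn_gt0 ?T0 // natrX lnXn ?ltr0n //.
  have -> : T%:R = (K * L)%N%:R * X%:R :> R by rewrite -natrM.
  rewrite lnM ?posrE ?ltr0n ?muln_gt0 ?K0 // -[(_ + _) *+ _]mulr_natl.
  by rewrite mulrDr addrA.
apply: (@le_trans _ _ ((1 + eps) * t * S')); first by rewrite ler_peMl.
have e1 : 0 <= 1 + eps by rewrite addr_ge0 // ltW.
rewrite -[leLHS]mulrA ler_wpM2l //; apply: le_trans tS' _.
by rewrite lnCT; move: lnX; lra.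
Qed.
End Mertens.

(** * Small primes *)

(** In characteristic zero the derivative is nonzero of smaller degree, hence coprime to [g]; [D] is
    a Bezout constant after clearing denominators and plays the part of the discriminant. *)
Lemma bezout_deriv (g : {poly int}) :
  irreducible_poly (map_poly intr g : {poly rat}) ->
  exists D : int, exists u v : {poly int}, D != 0 /\ forall x, u.[x] * g.[x] + v.[x] * g^`().[x] = D.
Proof.
move=> g_irr; have inj : injective (intr : int -> rat) by exact: intr_inj.
set gQ := map_poly intr g in g_irr.
have sg : (1 < size gQ)%N by case: g_irr.
have dgQ : gQ^`() != 0.
  apply/negP => /eqP /(congr1 (fun h : {poly rat} => h`_(size gQ).-2)); rewrite coef_deriv coef0.
  have -> : (size gQ).-2.+1 = (size gQ).-1 by lia.
  move/eqP; rewrite -lead_coefE -mulr_natr mulf_eq0 lead_coef_eq0 pnatr_eq0.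
  by case/orP => [/eqP g0|]; [rewrite g0 size_poly0 in sg | lia].
have co : coprimep gQ gQ^`().
  by apply: irreducible_coprime_small => //; apply: lt_size_deriv; rewrite -size_poly_gt0 ltnW.
have /Bezout_coprimepP[[u v] /=] := co.
rewrite -size_poly_eq1 => /size_poly1P[c c0 uvc].
have [u' [a a0 uE]] := rat_poly_scale u; have [v' [b b0 vE]] := rat_poly_scale v.
pose P : {poly int} := b *: (u' * g) + a *: (v' * g^`()).
have PE : map_poly intr P = (a%:~R * b%:~R * c)%:P :> {poly rat}.
  rewrite rmorphD /= !map_polyZ !rmorphM /= -deriv_map -/gQ.
  have -> : map_poly intr u' = (a%:~R)%:P * u by rewrite uE mul_polyC scalerA divff ?intr_eq0 // scale1r.
  have -> : map_poly intr v' = (b%:~R)%:P * v by rewrite vE mul_polyC scalerA divff ?intr_eq0 // scale1r.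
  by rewrite -uvc -!mul_polyC; ring.
have sP : (size P <= 1)%N by rewrite -(size_map_inj_poly inj) // PE size_polyC leq_b1.
exists P`_0, (b *: u'), (a *: v'); split.
  have := congr1 (fun h : {poly rat} => h`_0) PE; rewrite coef_map /= coefC eqxx => P0.
  by rewrite -(intr_eq0 rat) P0 !mulf_neq0 ?intr_eq0.
move=> x; transitivity P.[x]; last by rewrite [X in X.[_]](size1_polyC sP) hornerC.
by rewrite hornerD !hornerZ !hornerM !mulrA.
Qed.

Lemma dvdz_horner_sub (g : {poly int}) (m x y : int) : (m %| x - y)%Z -> (m %| g.[x] - g.[y])%Z.
Proof. by move=> mxy; rewrite horner_quoP dvdz_mulr. Qed.

(* [g(y) - g(x) = (y - x) q(y)] with [q(y) = g'(x)] mod [y - x], and the Bezout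
   relation bounds the [p]-adic valuation of [q(y)] by that of [D]. *)
Lemma root_class_rigid (g u v : {poly int}) (D x y : int) p k :
  prime p -> D != 0 -> (forall z, u.[z] * g.[z] + v.[z] * g^`().[z] = D) ->
  (logn p `|D| < k)%N ->
  ((p ^ (logn p `|D|).+1)%N%:Z %| y - x)%Z ->
  ((p ^ k)%N%:Z %| g.[x])%Z -> ((p ^ k)%N%:Z %| g.[y])%Z ->
  ((p ^ (k - logn p `|D|))%N%:Z %| y - x)%Z.
Proof.
move=> p_pr D0 bez; set e := logn p _ => ek pxy pgx pgy.
have [->|xy] := eqVneq y x; first by rewrite subrr dvdz0.
have [q qE] : exists q, g - g.[x]%:P = q * ('X - x%:P).
  by apply/factor_theorem; rewrite rootE !hornerE subrr.
have qx : q.[x] = g^`().[x].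
  have := congr1 (fun h : {poly int} => h^`().[x]) qE.
  by rewrite derivB derivM derivXsubC derivC subr0 mulr1 !hornerE subrr mulr0 add0r => ->.
have gq : g.[y] - g.[x] = q.[y] * (y - x).
  by have := congr1 (fun h : {poly int} => h.[y]) qE; rewrite !hornerE.
have pq : ~~ ((p ^ e.+1)%N%:Z %| q.[y])%Z.
  apply/negP => pqy.
  have pg' : ((p ^ e.+1)%N%:Z %| g^`().[x])%Z.
    by rewrite -qx -[q.[x]](subKr q.[y]) rpredB //; apply: dvdz_horner_sub.
  have : ((p ^ e.+1)%N%:Z %| D)%Z.
    rewrite -(bez x) rpredD // dvdz_mull //; apply: dvdz_trans pgx.
    by rewrite dvdzE !absz_nat dvdn_exp2l.
  by rewrite dvdzE absz_nat pfactor_dvdn ?absz_gt0 // ltnn.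
have qy0 : q.[y] != 0 by apply: contraNneq pq => ->; rewrite dvdz0.
have : ((p ^ k)%N%:Z %| q.[y] * (y - x))%Z by rewrite -gq rpredB.
rewrite !dvdzE !absz_nat abszM !pfactor_dvdn ?muln_gt0 ?absz_gt0 ?subr_eq0 ?qy0 //.
rewrite lognM ?absz_gt0 ?subr_eq0 //.
by move: pq; rewrite dvdzE absz_nat pfactor_dvdn ?absz_gt0 //; lia.
Qed.

Definition count_dvd (g : {poly int}) (m M : nat) : nat :=
  count (fun n : nat => (m %| g.[n%:Z])%Z) (iota 1 M).

(** With [e] the exponent of [p] in [D], solutions in one class mod [p ^ e.+1] agree mod
    [p ^ (k - e)] by [root_class_rigid], so that class and the quotient by [p ^ (k - e)] determine a
    solution. *)
Lemma count_dvd_le (g u v : {poly int}) (D : int) p k M (s : seq nat) :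
  prime p -> D != 0 -> (forall z, u.[z] * g.[z] + v.[z] * g^`().[z] = D) ->
  (logn p `|D| < k)%N ->
  (forall n : nat, ((p ^ k)%N%:Z %| g.[n%:Z])%Z -> n %% p ^ (logn p `|D|).+1 \in s)%N ->
  (count_dvd g (p ^ k) M <= size s * (M %/ p ^ (k - logn p `|D|)).+1)%N.
Proof.
move=> p_pr D0 bez; set e := logn p _ => ek sP.
pose t := [seq n <- iota 1 M | ((p ^ k)%N%:Z %| g.[n%:Z])%Z].
pose F n := (n %% p ^ e.+1, n %/ p ^ (k - e))%N.
rewrite /count_dvd -size_filter -/t -(size_map F).
rewrite -[(_ %/ _).+1](size_iota 0) -(size_allpairs pair); apply: uniq_leq_size; last first.
  move=> _ /mapP[n nt ->]; move: nt; rewrite mem_filter mem_iota => /andP[/sP ns nM].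
  apply: allpairs_f => //; rewrite mem_iota /= add0n ltnS leq_div2r //.
  by move: nM => /andP[].
rewrite map_inj_in_uniq ?filter_uniq ?iota_uniq // => x y.
rewrite !mem_filter => /andP[px _] /andP[py _] [xy1 xy2].
have : ((p ^ (k - e))%N%:Z %| y%:Z - x%:Z)%Z.
  apply: root_class_rigid bez ek _ px py => //.
  by rewrite -eqz_mod_dvd !modz_nat xy1.
rewrite -eqz_mod_dvd !modz_nat => /eqP [xy3].
by rewrite (divn_eq x (p ^ (k - e))) (divn_eq y (p ^ (k - e))) xy2 xy3.
Qed.

Lemma sum_logn_count (g : {poly int}) p M B :
  prime p -> (forall n, 0 < n <= M -> g.[n%:Z] != 0)%N ->
  (forall n, 0 < n <= M -> logn p `|g.[n%:Z]|%N <= B)%N ->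
  (\sum_(1 <= n < M.+1) logn p `|g.[n%:Z]|%N = \sum_(1 <= k < B.+1) count_dvd g (p ^ k) M)%N.
Proof.
move=> p_pr g0 gB.
transitivity (\sum_(1 <= n < M.+1) \sum_(1 <= k < B.+1) (k <= logn p `|g.[n%:Z]|%N))%N.
  apply: eq_big_nat => n /gB; set l := logn _ _ => lB.
  have cnt m : (\sum_(1 <= k < m.+1) (k <= l) = minn l m)%N.
    by elim: m => [|m IHm]; [rewrite big_geq ?minn0 | rewrite big_nat_recr //=; lia].
  by rewrite cnt; lia.
rewrite exchange_big; apply: eq_bigr => k _.
rewrite /count_dvd -sum1_count /index_iota subSS subn0 [RHS]big_mkcond big_seq [RHS]big_seq /=.
apply: eq_bigr => n; rewrite mem_iota add1n ltnS => nM.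
by rewrite dvdzE absz_nat pfactor_dvdn ?absz_gt0 ?g0 //; case: leqP.
Qed.

Lemma horner_nonneg_bounds (g : {poly int}) d : size g = d.+1 -> (forall i, 0 <= g`_i) ->
  exists2 V : nat, (0 < V)%N & forall m M : nat, (0 < m <= M)%N ->
    [/\ 0 < g.[m%:Z], (m ^ d <= `|g.[m%:Z]|)%N & (`|g.[m%:Z]| <= V * M ^ d)%N].
Proof.
move=> sg g0; exists (\sum_(i < d.+1) absz (g`_i)%R).+1%N => // m M /andP[m0 mM].
have lg : 1 <= g`_d.
  have : lead_coef g != 0 by rewrite lead_coef_eq0 -size_poly_eq0 sg.
  by rewrite lead_coefE sg /= -gtz0_ge1 lt_def g0 andbT.
have gE := horner_coef g m%:Z; rewrite sg in gE.
have low : m%:Z ^+ d <= g.[m%:Z].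
  rewrite gE big_ord_recr /=; apply: ler_wpDl.
    by apply: sumr_ge0 => i _; rewrite mulr_ge0 ?exprn_ge0.
  by rewrite ler_peMl ?exprn_ge0.
have mE : (m ^ d)%N%:Z = m%:Z ^+ d by rewrite -[LHS]natz natrX natz.
have pos : 0 < g.[m%:Z] by apply: lt_le_trans low; rewrite exprn_gt0.
split=> //; first by rewrite -lez_nat mE gtz0_abs.
rewrite -lez_nat gtz0_abs // gE.
apply: (@le_trans _ _ (\sum_(i < d.+1) (absz (g`_i)%R * M ^ d)%N%:Z)).
  apply: ler_sum => i _; rewrite PoszM gez0_abs // ler_wpM2l //.
  apply: le_trans (ler_expz_nat _ mM) _; rewrite lez_nat leq_pexp2l ?(leq_trans m0) //.
  by rewrite -ltnS.
have -> : \sum_(i < d.+1) (absz (g`_i)%R * M ^ d)%N%:Z = (\sum_(i < d.+1) absz (g`_i)%R * M ^ d)%N%:Z.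
  by rewrite -[RHS]natz natr_sum; apply: eq_bigr => i _; rewrite natz.
by rewrite -big_distrl lez_nat leq_mul2r leqnSn orbT.
Qed.

Section SmallPrimes.
Variable R : realType.

(** For [z = 1 / p] the first term feeds the Mertens sum, while the remainder is summable over
    [p]. *)
Lemma sum_geometric_le (z : R) B : 0 <= z <= 2^-1 ->
  \sum_(1 <= k < B.+1) z ^+ k <= z + 2 * z ^+ 2.
Proof.
move=> /andP[z0 z1]; case: B => [|B].
  by rewrite big_geq // addr_ge0 // mulr_ge0 // exprn_ge0.
suff : \sum_(1 <= k < B.+2) z ^+ k <= z + 2 * z ^+ 2 - 2 * z ^+ B.+2.
  by move/le_trans; apply; rewrite gerBl mulr_ge0 // exprn_ge0.
elim: B => [|B IHB]; first by rewrite big_nat1 expr1; lra.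
rewrite big_nat_recr //=; apply: le_trans (lerD IHB (lexx _)) _.
have : z * z ^+ B.+2 <= 2^-1 * z ^+ B.+2 by rewrite ler_wpM2r // exprn_ge0.
by rewrite -exprS; lra.
Qed.

(** Telescoping, from [1 / p ^ 2 <= 1 / (p - 1) - 1 / p]. *)
Lemma sum_inv_sq_le (q x : nat) : (0 < q)%N -> \sum_(q.+1 <= p < x.+1) (p%:R ^+ 2 : R)^-1 <= q%:R^-1.
Proof.
move=> q0; have [qx|xq] := leqP x q; first by rewrite big_geq ?invr_ge0.
suff : \sum_(q.+1 <= p < x.+1) (p%:R ^+ 2 : R)^-1 <= q%:R^-1 - x%:R^-1.
  by move/le_trans; apply; rewrite gerBl invr_ge0.
elim: x xq => // x IHx; rewrite ltnS leq_eqVlt => /orP[/eqP <-|qx].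
  rewrite big_nat1 -natr1; have : 0 < q%:R :> R by rewrite ltr0n.
  move: (q%:R) => u u0; rewrite -subr_ge0.
  have -> : u^-1 - (u + 1)^-1 - ((u + 1) ^+ 2)^-1 = u^-1 * ((u + 1) ^+ 2)^-1.
    by field; rewrite !gt_eqF // addr_gt0.
  by rewrite mulr_ge0 ?invr_ge0 ?sqr_ge0 // ltW.
rewrite big_nat_recr /=; last exact: ltnW.
apply: (@le_trans _ _ (q%:R^-1 - x%:R^-1 + (x.+1%:R ^+ 2)^-1)).
  by rewrite lerD2r IHx.
have : 0 < x%:R :> R by rewrite ltr0n (leq_trans _ qx).
rewrite -natr1; move: (x%:R) => u u0; rewrite -subr_ge0.
have -> : q%:R^-1 - (u + 1)^-1 - (q%:R^-1 - u^-1 + ((u + 1) ^+ 2)^-1) = u^-1 * ((u + 1) ^+ 2)^-1.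
  by field; rewrite ?gt_eqF ?ltr0n // addr_gt0.
by rewrite mulr_ge0 ?invr_ge0 ?sqr_ge0 // ltW.
Qed.

(** In each count [E / p ^ k] is the density term and [1] the rounding error, incurred only for the
    exponents [k <= B]. *)
Lemma sum_logn_le (g : {poly int}) p M B (c E : R) :
  prime p -> 0 <= c -> 0 <= E -> (forall n, 0 < n <= M -> g.[n%:Z] != 0)%N ->
  (forall n, 0 < n <= M -> logn p `|g.[n%:Z]|%N <= B)%N ->
  (forall k, (0 < k)%N -> (count_dvd g (p ^ k) M)%:R <= c * (E * p%:R^-1 ^+ k + 1)) ->
  (\sum_(1 <= n < M.+1) logn p `|g.[n%:Z]|%N)%N%:R <= c * (E * (p%:R^-1 + 2 * p%:R^-1 ^+ 2) + B%:R).
Proof.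
move=> p_pr c0 E0 g0 gB cnt; rewrite (sum_logn_count p_pr g0 gB) natr_sum.
apply: (@le_trans _ _ (\sum_(1 <= k < B.+1) c * (E * p%:R^-1 ^+ k + 1))).
  by rewrite big_nat_cond [leRHS]big_nat_cond; apply: ler_sum => k /andP[/andP[k0 _] _]; apply: cnt.
rewrite -mulr_sumr ler_wpM2l // big_split /= -mulr_sumr sumr_const_nat subSS subn0.
rewrite lerD2r ler_wpM2l // sum_geometric_le // invr_ge0 ler0n /=.
by rewrite lef_pV2 ?posrE ?ltr0n ?prime_gt0 // ler_nat prime_gt1.
Qed.

Lemma logn_values_bound (g : {poly int}) p M W : prime p -> (0 < W)%N ->
  (forall n, 0 < n <= M -> g.[n%:Z] != 0 /\ `|g.[n%:Z]| <= W)%N ->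
  exists2 B : nat, (forall n, 0 < n <= M -> logn p `|g.[n%:Z]|%N <= B)%N & B%:R * ln p%:R <= ln (W%:R : R).
Proof.
move=> p_pr W0 gW; have p1 := prime_gt1 p_pr; exists (trunc_log p W).
  move=> n nM; have [g0 gn] := gW n nM; apply: trunc_log_max => //.
  by apply: leq_trans gn; rewrite dvdn_leq ?absz_gt0 // pfactor_dvdnn.
have /andP[pW _] := trunc_log_bounds p1 W0.
rewrite mulr_natl -lnXn ?ltr0n ?prime_gt0 // -natrX; apply: ler_ln_nat => //.
by rewrite expn_gt0 prime_gt0.
Qed.

(** Roots may be multiple mod [p] here. Exponents [k <= e] get the trivial count [M], absorbed
    because [P / p ^ k >= 1]; larger ones use all [p ^ e.+1] residue classes. *)
Lemma sum_logn_bad_prime (g : {poly int}) p :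
  irreducible_poly (map_poly intr g : {poly rat}) -> prime p ->
  exists C : R, 0 <= C /\ forall M W : nat, (0 < W)%N ->
    (forall n, 0 < n <= M -> g.[n%:Z] != 0 /\ `|g.[n%:Z]| <= W)%N ->
    (\sum_(1 <= n < M.+1) logn p `|g.[n%:Z]|%N)%N%:R * ln p%:R <= C * (M%:R + ln W%:R).
Proof.
move=> g_irr p_pr; have [D [u [v [D0 bez]]]] := bezout_deriv g_irr.
set e := logn p `|D|%N; have p1 := prime_gt1 p_pr; have p0 := prime_gt0 p_pr.
pose c : R := (p ^ e.+1)%N%:R; pose P : R := (p ^ e)%N%:R.
have c0 : 0 <= c by rewrite ler0n.
have lnp := ln_nat_ge0 R p.
exists (c * (P * ln p%:R + 1)); split.
  by rewrite mulr_ge0 // addr_ge0 // !mulr_ge0.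
move=> M W W0 gW; have [B gB BW] := logn_values_bound p_pr W0 gW.
have pV k : p%:R^-1 ^+ k * (p ^ k)%N%:R = 1 :> R.
  by rewrite natrX -exprMn mulVf ?expr1n // pnatr_eq0 -lt0n.
have pV0 k : 0 <= p%:R^-1 ^+ k :> R by rewrite exprn_ge0 // invr_ge0.
have cnt k : (0 < k)%N -> (count_dvd g (p ^ k) M)%:R <= c * (M%:R * P * p%:R^-1 ^+ k + 1).
  move=> k0; have [ke|ek] := leqP k e.
    apply: (@le_trans _ _ M%:R); first by rewrite ler_nat -{2}(size_iota 1 M) count_size.
    have P1 : 1 <= P * p%:R^-1 ^+ k.
      by rewrite -[leLHS](pV k) [leRHS]mulrC ler_wpM2l // ler_nat leq_exp2l.
    have c1 : 1 <= c by rewrite ler1n expn_gt0 p0.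
    apply: (@le_trans _ _ (M%:R * P * p%:R^-1 ^+ k + 1)).
      by apply: ler_wpDr => //; rewrite -mulrA ler_peMr.
    by rewrite ler_peMl // addr_ge0 // mulr_ge0 // mulr_ge0.
  have := count_dvd_le (s := iota 0 (p ^ e.+1)) M p_pr D0 bez ek.
  rewrite size_iota -/e => H; apply: (@le_trans _ _ (p ^ e.+1 * (M %/ p ^ (k - e)).+1)%N%:R).
    by rewrite ler_nat; apply: H => n _; rewrite mem_iota /= add0n ltn_pmod // expn_gt0 p0.
  rewrite natrM ler_wpM2l // -natr1 lerD2r.
  have -> : M%:R * P * p%:R^-1 ^+ k = M%:R / (p ^ (k - e))%N%:R.
    rewrite exprVn -natrX -{1}(subnK (ltnW ek)) expnD natrM invfM -/P.
    by field; rewrite !pnatr_eq0 -!lt0n !expn_gt0 p0.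
  by rewrite ler_pdivlMr ?ltr0n ?expn_gt0 ?p0 // -natrM ler_nat leq_trunc_div.
have MP0 : 0 <= M%:R * P by rewrite mulr_ge0.
have g0 n : (0 < n <= M)%N -> g.[n%:Z] != 0 by case/gW.
have := sum_logn_le p_pr c0 MP0 g0 gB cnt; set S := _%:R => SB.
have zb : p%:R^-1 + 2 * p%:R^-1 ^+ 2 <= 1 :> R.
  have : 0 <= (p%:R^-1 : R) <= 2^-1.
    rewrite invr_ge0 ler0n lef_pV2 ?posrE ?ltr0n //.
    by rewrite ler_nat.
  by move: (p%:R^-1) => z; nra.
have {}SB : S <= c * (M%:R * P + B%:R).
  by apply: le_trans SB _; rewrite ler_wpM2l // lerD2r ler_piMr.
apply: (@le_trans _ _ (c * (M%:R * P + B%:R) * ln p%:R)); first by rewrite ler_wpM2r.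
rewrite -!mulrA ler_wpM2l // mulrDl.
have L0 := ln_nat_ge0 R W; have M0 : 0 <= M%:R :> R by [].
have PL : 0 <= P * ln p%:R by rewrite mulr_ge0.
have : 0 <= P * ln p%:R * ln (W%:R : R) by rewrite mulr_ge0.
rewrite -[M%:R * P * _]mulrA; move: (P * _) PL => w w0.
by move: BW; lra.
Qed.

Lemma sum_logn_bad_primes (g : {poly int}) q :
  irreducible_poly (map_poly intr g : {poly rat}) ->
  exists C : R, 0 <= C /\ forall M W : nat, (0 < W)%N ->
    (forall n, 0 < n <= M -> g.[n%:Z] != 0 /\ `|g.[n%:Z]| <= W)%N ->
    \sum_(0 <= p < q | prime p) (\sum_(1 <= n < M.+1) logn p `|g.[n%:Z]|%N)%N%:R * ln p%:R
      <= C * (M%:R + ln W%:R).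
Proof.
move=> g_irr; elim: q => [|q [C [C0 IHq]]].
  by exists 0; split=> // M W _ _; rewrite big_geq // mul0r.
have [p_pr|npr] := boolP (prime q); last first.
  exists C; split=> // M W W0 gW.
  by rewrite big_mkcond big_nat_recr //= (negPf npr) addr0 -big_mkcond; apply: IHq.
have [C' [C'0 H]] := sum_logn_bad_prime g_irr p_pr.
exists (C + C'); split=> [|M W W0 gW]; first exact: addr_ge0.
rewrite big_mkcond big_nat_recr //= p_pr -big_mkcond /= mulrDl.
by apply: lerD; [apply: IHq | apply: H].
Qed.

(** A prime [p > q0] divides neither [D] nor the leading coefficient, so each of the at most [n.+1]
    roots mod [p] extends to at most one class mod [p ^ k]. *)
Lemma sum_logn_good_prime (g : {poly int}) n :
  irreducible_poly (map_poly intr g : {poly rat}) -> size g = n.+2 ->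
  exists q0 : nat, forall p M W : nat, prime p -> (q0 < p)%N -> (0 < W)%N ->
    (forall m, 0 < m <= M -> g.[m%:Z] != 0 /\ `|g.[m%:Z]| <= W)%N ->
    (\sum_(1 <= m < M.+1) logn p `|g.[m%:Z]|%N)%N%:R * ln p%:R <=
      M%:R * ((size (roots_mod g p))%:R * (ln p%:R / p%:R))
      + 2 * n.+1%:R * M%:R * (ln p%:R / p%:R ^+ 2) + n.+1%:R * ln (W%:R : R).
Proof.
move=> g_irr sg; have [D [u [v [D0 bez]]]] := bezout_deriv g_irr.
exists (`|D| + `|lead_coef g|)%N => p M W p_pr qp W0 gW.
have p1 := prime_gt1 p_pr; have p0 := prime_gt0 p_pr; have lnp := ln_nat_ge0 R p.
have a0 : lead_coef g != 0 by rewrite lead_coef_eq0 -size_poly_eq0 sg.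
have pa : ~~ (p %| lead_coef g)%Z.
  by rewrite dvdzE absz_nat; apply/negP => /dvdn_leq; rewrite absz_gt0 => /(_ a0); lia.
have e0 : logn p `|D| = 0%N.
  rewrite lognE p_pr absz_gt0 D0 /=; case: ifP => // /dvdn_leq.
  by rewrite absz_gt0 D0 => /(_ isT); lia.
have [B gB BW] := logn_values_bound p_pr W0 gW.
pose c : R := (size (roots_mod g p))%:R; have c0 : 0 <= c by rewrite ler0n.
have cn : c <= n.+1%:R by rewrite ler_nat size_roots_mod.
have cnt k : (0 < k)%N -> (count_dvd g (p ^ k) M)%:R <= c * (M%:R * p%:R^-1 ^+ k + 1).
  move=> k0; have := count_dvd_le (k := k) (s := roots_mod g p) M p_pr D0 bez.
  rewrite e0 subn0 => /(_ k0) H.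
  apply: (@le_trans _ _ (size (roots_mod g p) * (M %/ p ^ k).+1)%N%:R).
    rewrite ler_nat; apply: H => m pm; rewrite expn1 mem_filter mem_iota add0n ltn_pmod // andbT.
    have pgm : (p %| g.[m%:Z])%Z.
      by apply: dvdz_trans pm; rewrite dvdzE !absz_nat -{1}[p]expn1 dvdn_exp2l.
    rewrite -[g.[_]](subrK g.[m%:Z]) rpredD //; apply: dvdz_horner_sub.
    by rewrite -eqz_mod_dvd -modz_nat modz_mod.
  rewrite natrM ler_wpM2l // -natr1 lerD2r exprVn -natrX.
  by rewrite ler_pdivlMr ?ltr0n ?expn_gt0 ?p0 // -natrM ler_nat leq_trunc_div.
have M0 : 0 <= M%:R :> R by [].
have g0 m : (0 < m <= M)%N -> g.[m%:Z] != 0 by case/gW.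
have := sum_logn_le p_pr c0 M0 g0 gB cnt; set S := _%:R => SB.
apply: (@le_trans _ _ (c * (M%:R * (p%:R^-1 + 2 * p%:R^-1 ^+ 2) + B%:R) * ln p%:R)).
  by rewrite ler_wpM2r.
rewrite -/c exprVn; move: (p%:R^-1) => z.
have t0 : 0 <= ln p%:R / p%:R ^+ 2 :> R by rewrite divr_ge0 // exprn_ge0.
have -> : c * (M%:R * (z + 2 * (p%:R ^+ 2)^-1) + B%:R) * ln p%:R =
  M%:R * (c * (ln p%:R * z)) + 2 * c * M%:R * (ln p%:R / p%:R ^+ 2) + c * (B%:R * ln p%:R) by ring.
apply: lerD; first (apply: lerD => //).
  by rewrite ler_wpM2r // ler_wpM2r // ler_wpM2l.
apply: (@le_trans _ _ (c * ln W%:R)); first by rewrite ler_wpM2l.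
by rewrite ler_wpM2r // ln_nat_ge0.
Qed.
End SmallPrimes.

Section SmallPrimesTotal.
Variable R : realType.

(** Primes up to [q] cost [O(M)]. Beyond [q], the three terms of [sum_logn_good_prime] are bounded
    by the Mertens estimate, by the tail of [1 / p ^ 2] and by Chebyshev's bound. *)
Lemma sum_logn_small_primes (g : {poly int}) n K (eps : R) :
  irreducible_poly (map_poly intr g : {poly rat}) -> size g = n.+2 -> (forall i, 0 <= g`_i) ->
  (0 < K)%N -> 0 < eps ->
  exists C : R, forall M, (1 < M)%N ->
    \sum_(0 <= p < (K * M).+1 | prime p) (\sum_(1 <= m < M.+1) logn p `|g.[m%:Z]|%N)%N%:R * ln p%:R
      <= (1 + eps) * (M%:R * ln M%:R) + C * M%:R.
Proof.
move=> g_irr sg g0 K0 eps0.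
have [V V0 gV] := horner_nonneg_bounds sg g0.
have [q0 good] := sum_logn_good_prime R g_irr sg.
have [p0 mertens] := sum_roots_mod_le R g_irr sg.
have e1 : 0 < eps / 2 by rewrite divr_gt0.
have [C1 {}mertens] := mertens _ e1.
(* Besides passing both thresholds, [q] makes the tail [2 d ln x / q], with [d = n.+1], at most
   [(eps / 2) ln x]. *)
pose q := (q0 + p0 + (Num.truncn (4 * n.+1%:R / eps)).+1)%N.
have q_gt0 : (0 < q)%N by rewrite /q addnS.
have qeps : 2 * n.+1%:R / q%:R <= eps / 2 :> R.
  have h : 4 * n.+1%:R / eps <= q%:R.
    apply: le_trans (ltW (truncnS_gt _)) _; by rewrite ler_nat /q leq_addl.
  rewrite ler_pdivrMr ?ltr0n //; rewrite ler_pdivrMr // in h.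
  by move: h; lra.
have [Cb [Cb0 bad]] := sum_logn_bad_primes R q.+1 g_irr.
pose d1 : R := n.+1%:R; pose C2 : R := 2 * ln 4%:R + 2.
pose c : R := ln V%:R / ln 2%:R + d1.
exists ((1 + eps / 2) * (ln K%:R + C1) + eps / 2 * ln K%:R + d1 * c * C2 * K%:R
        + Cb * (1 + (ln V%:R + d1))) => M M1.
have M0 : (0 < M)%N by apply: ltnW.
pose W := (V * M ^ n.+1)%N; pose x := (K * M)%N.
have W0 : (0 < W)%N by rewrite muln_gt0 V0 expn_gt0 M0.
have gW m : (0 < m <= M)%N -> g.[m%:Z] != 0 /\ (`|g.[m%:Z]| <= W)%N.
  by move=> mM; have [gm _ gle] := gV m M mM; rewrite gt_eqF.
have x0 : (0 < x)%N by rewrite muln_gt0 K0.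
have xM : (M <= x)%N by rewrite leq_pmull.
have x2 : (2 <= x)%N by apply: leq_trans xM.
have lnx : ln x%:R = ln K%:R + ln M%:R :> R by rewrite natrM lnM // posrE ltr0n.
have lnW : ln W%:R = ln V%:R + d1 * ln M%:R :> R.
  by rewrite natrM lnM ?posrE ?ltr0n ?expn_gt0 ?M0 // natrX lnXn ?ltr0n // mulr_natl.
have d10 : 0 <= d1 by [].
have lnV := ln_nat_ge0 R V; have lnM := ln_nat_ge0 R M; have lnK := ln_nat_ge0 R K.
have ln2 : 0 < ln 2%:R :> R by rewrite ln_gt0 // ltr1n.
(* Since [x >= 2], the constant [ln V] is at most [(ln V / ln 2) ln x], whence [c]. *)
have lnWx : ln W%:R <= c * ln x%:R.
  rewrite lnW mulrDl; apply: lerD; last by rewrite ler_wpM2l // lnx lerDr.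
  rewrite mulrAC ler_pdivlMr // ler_wpM2l //.
  by apply: ler_ln_nat.
have lnWM : ln W%:R <= (ln V%:R + d1) * M%:R.
  rewrite lnW mulrDl; apply: lerD; last by rewrite ler_wpM2l // ln_nat_le.
  by rewrite ler_peMr // ler1n.
pose F p : R := (\sum_(1 <= m < M.+1) logn p `|g.[m%:Z]|%N)%N%:R * ln p%:R.
have F0 p : 0 <= F p by rewrite mulr_ge0 // ln_nat_ge0.
have badM : \sum_(0 <= p < q.+1 | prime p) F p <= Cb * (1 + (ln V%:R + d1)) * M%:R.
  apply: le_trans (bad M W W0 gW) _; rewrite -mulrA ler_wpM2l // mulrDl mul1r lerD2l.
  exact: lnWM.
have goodM : \sum_(q.+1 <= p < x.+1 | prime p) F p <=
    M%:R * ((1 + eps / 2) * (ln x%:R + C1)) + eps / 2 * M%:R * ln x%:R + d1 * c * C2 * K%:R * M%:R.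
  apply: (@le_trans _ _ (\sum_(q.+1 <= p < x.+1 | prime p)
     (M%:R * ((size (roots_mod g p))%:R * (ln p%:R / p%:R))
      + 2 * d1 * M%:R * (ln p%:R / p%:R ^+ 2) + d1 * ln (W%:R : R)))).
    rewrite big_nat_cond [leRHS]big_nat_cond; apply: ler_sum => p /andP[/andP[qp _] p_pr].
    by apply: good => //; apply: leq_ltn_trans qp; rewrite /q -addnA leq_addr.
  rewrite !big_split /= -!mulr_sumr; apply: lerD; first apply: lerD.
  - by rewrite ler_wpM2l //; apply: mertens => //; rewrite /q addnAC leq_addl.
  - apply: (@le_trans _ _ (2 * d1 * M%:R * (ln x%:R / q%:R))).
      rewrite ler_wpM2l ?mulr_ge0 //.
      apply: (@le_trans _ _ (\sum_(q.+1 <= p < x.+1) ln x%:R * (p%:R ^+ 2)^-1)); last first.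
        by rewrite -mulr_sumr ler_wpM2l ?ln_nat_ge0 // sum_inv_sq_le.
      rewrite big_mkcond big_nat_cond [leRHS]big_nat_cond; apply: ler_sum => p /andP[/andP[qp px] _].
      have p_gt0 : (0 < p)%N by apply: leq_ltn_trans qp.
      case: ifP => _; last by rewrite mulr_ge0 ?ln_nat_ge0 // invr_ge0 exprn_ge0.
      by rewrite ler_wpM2r ?invr_ge0 ?exprn_ge0 // ler_ln_nat.
    have -> : 2 * d1 * M%:R * (ln x%:R / q%:R) = 2 * n.+1%:R / q%:R * (M%:R * ln x%:R) by rewrite /d1; ring.
    by rewrite -[leRHS]mulrA ler_wpM2r // mulr_ge0 // ln_nat_ge0.
  - apply: (@le_trans _ _ (\sum_(0 <= p < x.+1 | prime p) d1 * (c * ln x%:R))).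
      apply: (@le_trans _ _ (\sum_(q.+1 <= p < x.+1 | prime p) d1 * (c * ln x%:R))).
        by rewrite mulr_sumr; apply: ler_sum => p _; rewrite ler_wpM2l.
      have c0 : 0 <= d1 * (c * ln x%:R).
        by rewrite !mulr_ge0 ?ln_nat_ge0 // addr_ge0 // divr_ge0 // ltW.
      have [qx|xq] := leqP q.+1 x.+1; last by rewrite big_geq 1?ltnW // sumr_ge0.
      by rewrite [leRHS](big_cat_nat (n := q.+1)) //= lerDr sumr_ge0.
    rewrite -!mulr_sumr -!mulrA ler_wpM2l //.
    have c0 : 0 <= c by rewrite addr_ge0 // divr_ge0 // ltW.
    by rewrite ler_wpM2l // -natrM; apply: prime_count_le.
have total : \sum_(0 <= p < x.+1 | prime p) F p <=
    \sum_(0 <= p < q.+1 | prime p) F p + \sum_(q.+1 <= p < x.+1 | prime p) F p.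
  have [qx|xq] := leqP q.+1 x.+1; first by rewrite [leLHS](big_cat_nat (n := q.+1)).
  by rewrite [X in _ + X]big_geq 1?ltnW // addr0 [leRHS](big_cat_nat (n := x.+1)) 1?ltnW //= lerDl sumr_ge0.
apply: le_trans total _; apply: le_trans (lerD badM goodM) _; rewrite lnx.
by rewrite le_eqVlt; apply/orP; left; apply/eqP; field.
Qed.
End SmallPrimesTotal.

(** * Shift to nonnegative coefficients *)

Lemma irreducible_poly_opp (F : fieldType) (p : {poly F}) :
  irreducible_poly p -> irreducible_poly (- p).
Proof.
case=> p1 pP; split; first by rewrite size_polyN.
move=> q q1; rewrite dvdpNr => /(pP q q1) qp.
by rewrite -scaleN1r eqp_sym (eqp_trans (eqp_scale _ _)) ?oppr_eq0 ?oner_eq0 // eqp_sym.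
Qed.

(** Substituting [X - c] undoes the shift, and both substitutions preserve divisibility and size. *)
Lemma irreducible_poly_shift (F : fieldType) (p : {poly F}) c :
  irreducible_poly p -> irreducible_poly (p \Po ('X + c%:P)).
Proof.
have s2 (a : F) : size ('X + a%:P) = 2 by rewrite size_XaddC.
case=> p1 pP; split; first by rewrite size_comp_poly2.
move=> q q1 qp.
have qK (h : {poly F}) : (h \Po ('X + (- c)%:P)) \Po ('X + c%:P) = h.
  by rewrite -comp_polyA comp_polyD comp_polyX comp_polyC -addrA -polyCD subrr addr0 comp_polyXr.
have pK (h : {poly F}) : (h \Po ('X + c%:P)) \Po ('X + (- c)%:P) = h.
  by rewrite -comp_polyA comp_polyD comp_polyX comp_polyC -addrA -polyCD addNr addr0 comp_polyXr.
have /pP : size (q \Po ('X + (- c)%:P)) != 1%N by rewrite size_comp_poly2.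
have := dvdp_comp_poly ('X + (- c)%:P) qp; rewrite pK => qp' /(_ qp') /andP[_ pq].
by rewrite /eqp qp; have := dvdp_comp_poly ('X + c%:P) pq; rewrite qK.
Qed.

Lemma lead_gt0_eventually_pos (q : {poly int}) : 0 < lead_coef q ->
  exists B : nat, forall n : nat, (B <= n)%N -> 0 < q.[n%:Z].
Proof.
elim/poly_ind: q => [|q c IHq]; first by rewrite lead_coef0.
have [->|q0] := eqVneq q 0.
  by rewrite mul0r add0r lead_coefC => c0; exists 0%N => n _; rewrite hornerC.
rewrite lead_coefDl ?lead_coefMX; last first.
  by rewrite size_mulX // size_polyC; have := size_poly_gt0 q; rewrite q0; case: (c != 0); lia.
move=> /IHq[B BP]; exists (B + `|c|.+1)%N => n Bn; rewrite hornerMXaddC.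
have := BP n (leq_trans (leq_addr _ _) Bn); move: (q.[n%:Z]) => z z0.
have : n%:Z <= z * n%:Z by nia.
lia.
Qed.

Lemma comp_poly_taylor (p : {poly int}) (a : int) :
  p \Po ('X + a%:P) = \poly_(i < size p) p^`N(i).[a].
Proof.
rewrite /comp_poly addrC nderiv_taylor; last exact: mulrC.
rewrite size_map_polyC poly_def; apply: eq_bigr => i _.
by rewrite nderivn_map horner_map /= mul_polyC.
Qed.

Lemma lead_coef_nderivn_gt0 (p : {poly int}) i : 0 < lead_coef p -> (i < size p)%N ->
  0 < lead_coef p^`N(i).
Proof.
move=> lp ip; have cE : (p^`N(i))`_((size p).-1 - i) = lead_coef p *+ 'C((size p).-1, i).
  by rewrite coef_nderivn subnKC ?lead_coefE //; lia.
have c0 : 0 < (p^`N(i))`_((size p).-1 - i) by rewrite cE pmulrn_lgt0 // bin_gt0; lia.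
suff -> : lead_coef p^`N(i) = (p^`N(i))`_((size p).-1 - i) by [].
rewrite lead_coefE; congr (_`_ _); apply/eqP; rewrite eqn_leq; apply/andP; split.
  suff : (size p^`N(i) <= size p - i)%N by lia.
  by rewrite size_poly.
have : ((size p).-1 - i < size p^`N(i))%N.
  by rewrite ltnNge; apply/negP => /leq_sizeP/(_ _ (leqnn _)) c00; rewrite c00 in c0.
lia.
Qed.

(** After a change of sign the leading coefficient is positive. The coefficients of [f(X + a)] are
    the normalized derivatives of [f] at [a], polynomials in [a] with positive leading coefficient,
    hence positive for large [a]. *)
Lemma nonneg_shift_exists (f : {poly int}) d :
  irreducible_poly (map_poly intr f : {poly rat}) -> size f = d.+1 ->
  exists (a : nat) (g : {poly int}),
    [/\ irreducible_poly (map_poly intr g : {poly rat}), size g = d.+1, forall i, 0 <= g`_i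
      & forall m : nat, `|g.[m%:Z]|%N = `|f.[(m + a)%N%:Z]|%N].
Proof.
wlog lf : f / 0 < lead_coef f => [wl|f_irr sf].
  move=> f_irr sf; have [lf|lf|lf] := ltgtP 0 (lead_coef f); first exact: wl.
    have [|||a [g [g_irr sg g0 gf]]] := wl (- f).
    - by rewrite lead_coefN oppr_gt0.
    - by rewrite rmorphN; apply: irreducible_poly_opp.
    - by rewrite size_polyN.
    by exists a, g; split=> // m; rewrite gf hornerN abszN.
  by move/esym/eqP: lf; rewrite lead_coef_eq0 -size_poly_eq0 sf.
have [a aP] : exists a : nat, forall i, (i < size f)%N -> 0 < f^`N(i).[a%:Z].
  suff [B BP] : exists B : nat, forall n : nat, (B <= n)%N -> forall i, (i < size f)%N -> 0 < f^`N(i).[n%:Z].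
    by exists B; apply: BP.
  elim: {-2}(size f) (leqnn (size f)) => [|k IHk] kf; first by exists 0%N.
  have [B1 B1P] := IHk (ltnW kf).
  have [B2 B2P] := lead_gt0_eventually_pos (lead_coef_nderivn_gt0 lf kf).
  exists (B1 + B2)%N => n Bn i; rewrite ltnS leq_eqVlt => /orP[/eqP ->|ik].
    by apply: B2P; apply: leq_trans Bn; apply: leq_addl.
  by apply: B1P => //; apply: leq_trans Bn; apply: leq_addr.
exists a, (f \Po ('X + a%:Z%:P)); split.
- rewrite map_comp_poly rmorphD /= map_polyX map_polyC /=.
  exact: irreducible_poly_shift.
- by rewrite size_comp_poly2 // size_XaddC.
- by move=> i; rewrite comp_poly_taylor coef_poly; case: ifP => // /aP/ltW.
- by move=> m; rewrite horner_comp !hornerE.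
Qed.

(** * Assembly *)

Section Assembly.
Variable R : realType.

Lemma lcm_values_gt0 f N : (0 < lcm_values f N)%N.
Proof.
rewrite /lcm_values; apply: (big_ind (fun m => 0 < m)%N) => // [a b a0 b0|i fi].
  by rewrite lcmn_gt0 a0.
by rewrite absz_gt0.
Qed.

Lemma dvdn_lcm_values f N m : (0 < m <= N)%N -> f.[m%:Z] != 0 ->
  (`|f.[m%:Z]| %| lcm_values f N)%N.
Proof.
move=> /andP[m0 mN] fm; rewrite /lcm_values -big_filter.
have : m \in [seq i <- index_iota 1 N.+1 | f.[i%:Z] != 0] by rewrite mem_filter fm mem_index_iota m0.
elim: (filter _ _) => // a s IHs; rewrite inE big_cons => /orP[/eqP <-|/IHs ms].
  exact: dvdn_lcml.
exact: dvdn_trans ms (dvdn_lcmr _ _).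
Qed.

Lemma prime_dvd_rad p m : (0 < m)%N -> prime p -> (p %| m)%N -> (p %| Defs.rad m)%N.
Proof.
move=> m0 p_pr pm; have : p \in primes m by rewrite mem_primes p_pr m0.
rewrite /Defs.rad; elim: (primes m) => // a s IHs; rewrite inE big_cons => /orP[/eqP <-|/IHs ms].
  exact: dvdn_mulr.
exact: dvdn_mull.
Qed.

Lemma rad_gt0 m : (0 < Defs.rad m)%N.
Proof. by rewrite /Defs.rad big_seq prodn_cond_gt0 // => p; rewrite mem_primes => /and3P[/prime_gt0]. Qed.

Lemma sum_ln_primes_le_ell f N a b :
  \sum_(a <= p < b | prime p) (p %| lcm_values f N)%N%:R * ln (p%:R : R) <= ln (ell f N)%:R.
Proof.
apply: sum_ln_prime_powers_le => [|p _ p_pr]; first exact: rad_gt0.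
case: (boolP (p %| _)%N) => [pL|_]; last by rewrite expn0 dvd1n.
by rewrite expn1; apply: prime_dvd_rad => //; apply: lcm_values_gt0.
Qed.

Lemma ln_nat_logn (k b : nat) : (0 < k)%N -> (k < b)%N ->
  ln (k%:R : R) = \sum_(0 <= p < b | prime p) (logn p k)%:R * ln p%:R.
Proof.
move=> k0; case: b => // b kb; rewrite ltnS in kb.
rewrite -[in LHS](partnT k0) (widen_partn _ kb) ln_natM_prod => [|p _]; last first.
  have [/prime_gt0 p0|np] := boolP (prime p); first by rewrite expn_gt0 p0.
  by rewrite lognE (negPf np).
rewrite [RHS]big_mkcond; apply: eq_bigr => p _; case: ifP => [p_pr|np].
  by rewrite natrX lnXn ?ltr0n ?prime_gt0 // mulr_natl.
by rewrite lognE np /= expn0 ln1.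
Qed.

(** Half of Stirling's formula, by induction from [m ln (1 + 1 / m) <= 1]. *)
Lemma sum_ln_ge (M : nat) : (0 < M)%N ->
  M%:R * ln M%:R - M%:R <= \sum_(1 <= m < M.+1) ln (m%:R : R).
Proof.
elim: M => // [[|M]] IHM _; first by rewrite big_nat1 ln1 mulr0 sub0r oppr_le0.
rewrite big_nat_recr //=; apply: le_trans (lerD (IHM isT) (lexx _)).
set m := M.+1; have m0 : 0 < m%:R :> R by rewrite ltr0n.
have -> : ln m.+1%:R = ln m%:R + ln (1 + m%:R^-1) :> R.
  rewrite -lnM ?posrE ?addr_gt0 ?invr_gt0 //; congr ln.
  by rewrite mulrDr mulr1 divff ?gt_eqF // natr1.
have : m%:R * ln (1 + m%:R^-1) <= 1 :> R.
  rewrite mulrC -ler_pdivlMr // div1r.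
  by rewrite le_ln1Dx // (lt_trans (ltrN10 R)) // invr_gt0.
rewrite -[m.+1%:R]natr1; set v := ln (1 + _); set u := ln _; set w : R := m%:R.
lra.
Qed.

Lemma ln_nat_eventually_ge (B : R) : exists N0 : nat, forall N, (N0 <= N)%N -> B <= ln N%:R.
Proof.
have ln2 : 0 < ln 2%:R :> R by rewrite ln_gt0 // ltr1n.
pose k := (Num.truncn (B / ln 2%:R)).+1; exists (2 ^ k)%N => N NN.
apply: le_trans (ler_ln_nat R _ NN); last by rewrite expn_gt0.
rewrite natrX lnXn ?ltr0n // -[leRHS]mulr_natl -ler_pdivrMr //.
exact/ltW/truncnS_gt.
Qed.

(** The choice of [e] gives [(1 + eps) (1 - e) ^ 2 >= 1 + eps / 2]: one factor [1 - e] is in the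
    statement, the other pays for [N - a >= (1 - e) N], and the spare [(eps / 2) ln N] absorbs
    [ln 2] and [C]. *)
Lemma shifted_NlnN (eps C : R) (a : nat) : 0 < eps ->
  let e := eps / (4 * (1 + eps)) in
  exists N0 : nat, forall N, (N0 <= N)%N ->
    (1 < N - a)%N /\
    N%:R * ln N%:R <= (1 + eps) * ((1 - e) * ((N - a)%:R * ln (N - a)%:R) - C * (N - a)%:R).
Proof.
move=> eps0 e; have ep : 0 < 1 + eps by rewrite addr_gt0.
have e0 : 0 < e by rewrite divr_gt0 // mulr_gt0.
have eE : e * (1 + eps) = eps / 4 by rewrite /e; field; rewrite gt_eqF.
have e1 : e < 1.
  by rewrite /e ltr_pdivrMr ?mulr_gt0 //; lra.
pose D := (1 + eps) * (ln 2%:R + `|C|) / (eps / 2).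
have [N1 N1P] := ln_nat_eventually_ge D.
(* The summands ensure respectively [ln N >= D], [N - a >= N / 2] with [N - a > 1], and
   [a <= e N]. *)
exists (N1 + (2 * a + 4) + (Num.truncn (a%:R / e)).+1)%N => N NN; split; first by lia.
have N2a : (2 * a + 4 <= N)%N by lia.
have {N1P} LD : D <= ln N%:R by apply: N1P; lia.
have aN : a%:R <= e * N%:R.
  have h : a%:R / e <= N%:R.
    apply: le_trans (ltW (truncnS_gt _)) _; rewrite ler_nat; apply: leq_trans NN.
    exact: leq_addl.
  by rewrite mulrC -ler_pdivrMr.
set M := (N - a)%N; have ME : M%:R = N%:R - a%:R :> R by rewrite natrB //; lia.
have N0 : 0 < N%:R :> R by rewrite ltr0n; lia.
have lnM : ln N%:R - ln 2%:R <= ln M%:R :> R.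
  rewrite lerBlDr -lnM ?posrE ?ltr0n -?natrM //; last by lia.
  by apply: ler_ln_nat; lia.
have MN : M%:R <= N%:R :> R by rewrite ler_nat leq_subr.
have MeN : (1 - e) * N%:R <= M%:R by rewrite ME mulrBl mul1r; lra.
have l2 : 0 <= ln 2%:R :> R := ln_nat_ge0 R 2.
have lN2 : 0 <= ln N%:R - ln 2%:R :> R.
  rewrite subr_ge0; apply: ler_ln_nat => //.
  exact: leq_trans (leq_trans (_ : 2 <= 4)%N (leq_addl (2 * a) 4)) N2a.
have CM : C * M%:R <= `|C| * N%:R.
  by apply: le_trans (ler_wpM2r _ (ler_norm C)) _ => //; rewrite ler_wpM2l.
have MlnM : (1 - e) * N%:R * (ln N%:R - ln 2%:R) <= M%:R * ln M%:R.
  by apply: ler_pM => //; rewrite mulr_ge0 ?subr_ge0 ?(ltW e1) // ltW.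
have e1' : 0 <= 1 - e by rewrite subr_ge0 ltW.
have E2 : (1 - e) * ((1 - e) * N%:R * (ln N%:R - ln 2%:R)) <= (1 - e) * (M%:R * ln M%:R) by rewrite ler_wpM2l.
apply: (@le_trans _ _ ((1 + eps) * ((1 - e) * ((1 - e) * N%:R * (ln N%:R - ln 2%:R)) - `|C| * N%:R))); last first.
  by rewrite (ler_wpM2l (ltW ep)) //; lra.
have -> : (1 + eps) * ((1 - e) * ((1 - e) * N%:R * (ln N%:R - ln 2%:R)) - `|C| * N%:R) =
   N%:R * ((1 + eps) * (1 - e) ^+ 2 * (ln N%:R - ln 2%:R) - (1 + eps) * `|C|) by ring.
rewrite ler_wpM2l ?(ltW N0) //.
have D2 : (1 + eps) * (ln 2%:R + `|C|) <= eps / 2 * ln N%:R.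
  by move: LD; rewrite /D ler_pdivrMr ?divr_gt0 // [ln _ * _]mulrC.
have k1 : 1 + eps / 2 <= (1 + eps) * (1 - e) ^+ 2.
  have -> : (1 + eps) * (1 - e) ^+ 2 = (1 + eps) - 2 * (e * (1 + eps)) + e ^+ 2 * (1 + eps) by ring.
  rewrite eE; have : 0 <= e ^+ 2 * (1 + eps) by rewrite mulr_ge0 ?exprn_ge0 // ltW.
  by lra.
have k2 : (1 + eps / 2) * (ln N%:R - ln 2%:R) <= (1 + eps) * (1 - e) ^+ 2 * (ln N%:R - ln 2%:R).
  by rewrite ler_wpM2r.
have : 0 <= eps / 2 * ln (2%:R : R) by rewrite mulr_ge0 // ltW // divr_gt0.
by move: k2 D2; lra.
Qed.
End Assembly.

Unset Implicit Arguments.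

Theorem theorem1p4 (R : realType) (f : {poly int}) (d : nat)
    (f_irr : irreducible_poly (map_poly intr f : {poly rat}))
    (f_deg : size f = d.+1) (d_ge2 : (2 <= d)%N) :
  forall eps : R, 0 < eps ->
  exists N0 : nat, forall N : nat, (0 < N)%N -> (N0 <= N)%N ->
    2 / d%:R * N%:R * ln (N%:R : R) <= (1 + eps) * ln ((ell f N)%:R : R).
Proof.
case: d f_deg d_ge2 => [|n] // sf n1 eps eps0; rewrite ltnS in n1.
have [a [g [g_irr sg g0 gf]]] := nonneg_shift_exists f_irr sf.
have [K large] := sum_logn_large_prime sg g0.
have [V V0 gV] := horner_nonneg_bounds sg g0.
pose e := eps / (4 * (1 + eps)).
have e0 : 0 < e by rewrite divr_gt0 // mulr_gt0 // addr_gt0.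
(* [K] may be zero, so the cutoff is [K.+1 * M]; primes above it are also above [K * M]. *)
have [C small] := sum_logn_small_primes (K := K.+1) g_irr sg g0 (ltn0Sn K) e0.
(* The error [|C| M] comes from the small primes, [n.+1 M] from the Stirling bound. *)
have [N0 N0P] := shifted_NlnN (`|C| + n.+1%:R) a eps0.
exists N0 => N _ NN0; have [M1 NlnN] := N0P N NN0; move: M1 NlnN.
set M := (N - a)%N => M1 NlnN; have M0 : (0 < M)%N by apply: ltnW.
(* [b] exceeds the cutoff [x] and every [|g(m)|], so primes below [b] suffice to factor the
   values. *)
pose x := (K.+1 * M)%N; pose b := (x + V * M ^ n.+1).+1.
pose al p := (\sum_(1 <= m < M.+1) logn p `|g.[m%:Z]|%N)%N.
have gpos m : (0 < m <= M)%N -> (0 < `|g.[m%:Z]|)%N.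
  by move=> mM; have [gm _ _] := gV m M mM; rewrite absz_gt0 gt_eqF.
have lower : n.+1%:R * (M%:R * ln M%:R - M%:R) <= \sum_(1 <= m < M.+1) ln (`|g.[m%:Z]|%N%:R : R).
  apply: (@le_trans _ _ (\sum_(1 <= m < M.+1) n.+1%:R * ln (m%:R : R))).
    by rewrite -mulr_sumr ler_wpM2l // sum_ln_ge.
  rewrite big_nat_cond [leRHS]big_nat_cond; apply: ler_sum => m /andP[mM _].
  have [_ mg _] := gV m M mM; case/andP: mM => m0 _.
  rewrite mulr_natl -lnXn ?ltr0n // -natrX ler_ln_nat // expn_gt0 m0 //.
have factor : \sum_(1 <= m < M.+1) ln (`|g.[m%:Z]|%N%:R : R) =
    \sum_(0 <= p < b | prime p) (al p)%:R * ln p%:R.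
  transitivity (\sum_(1 <= m < M.+1) \sum_(0 <= p < b | prime p) (logn p `|g.[m%:Z]|%N)%:R * ln (p%:R : R)).
    apply: eq_big_nat => m mM; apply: ln_nat_logn; first exact: gpos.
    by have [_ _ gm] := gV m M mM; rewrite ltnS (leq_trans gm) // leq_addl.
  by rewrite exchange_big; apply: eq_bigr => p _; rewrite -mulr_suml -natr_sum.
have upper : \sum_(x.+1 <= p < b | prime p) (al p)%:R * ln p%:R <= 'C(n.+1, 2)%:R * ln ((ell f N)%:R : R).
  apply: (@le_trans _ _ (\sum_(x.+1 <= p < b | prime p) 'C(n.+1, 2)%:R * ((p %| lcm_values f N)%N%:R * ln (p%:R : R)))).
    rewrite big_nat_cond [leRHS]big_nat_cond; apply: ler_sum => p /andP[/andP[xp _] p_pr].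
    rewrite mulrA ler_wpM2r ?ln_nat_ge0 // -natrM ler_nat.
    (* A prime not dividing the lcm divides no [g(m)], which is [f(m + a)] up to sign with
       [m + a <= N], so its exponent is zero. *)
    have [pL|pL] := boolP (p %| lcm_values f N)%N.
      rewrite muln1; apply: large => //; apply: leq_trans xp; rewrite ltnS leq_mul2r leqnSn orbT //.
    rewrite muln0 leqn0 /al big_nat_cond big1 // => m /andP[mM _].
    apply/eqP; rewrite -leqn0 leqNgt -pfactor_dvdn ?gpos // expn1.
    apply: contra pL => /dvdn_trans; apply; rewrite gf; apply: dvdn_lcm_values.
      by move: mM M0; rewrite /M; clear; lia.
    by rewrite -absz_gt0 -gf gpos.
  by rewrite -mulr_sumr ler_wpM2l // sum_ln_primes_le_ell.
have main : n.+1%:R * (M%:R * ln M%:R - M%:R) <=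
    (1 + e) * (M%:R * ln M%:R) + C * M%:R + 'C(n.+1, 2)%:R * ln (ell f N)%:R.
  apply: le_trans lower _; rewrite factor (big_cat_nat (n := x.+1)) //=; last first.
    by rewrite ltnS leq_addr.
  by apply: lerD => //; apply: small.
have n0 : 0 < n%:R :> R by rewrite ltr0n.
have d0 : 0 < n.+1%:R :> R by rewrite ltr0n.
have binE : 'C(n.+1, 2)%:R = n.+1%:R * n%:R / 2 :> R.
  apply: (mulIf (_ : 2 != 0 :> R)); first by rewrite pnatr_eq0.
  by rewrite mulfVK ?pnatr_eq0 // -!natrM bin2 muln2 halfK /= oddM /= andNb subn0.
rewrite binE in main.
have MlnM0 : 0 <= M%:R * ln M%:R :> R by rewrite mulr_ge0 // ln_nat_ge0.
set L := ln (ell f N)%:R in main *; set X := M%:R * ln M%:R in main NlnN MlnM0.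
rewrite -/e in NlnN.
(* With [d = n + 1], [main] reads [(n - e) X - (C + d) M <= n (d / 2) L]. As [n >= 1], replacing [e]
   by [n e] and [C + d] by [n (|C| + d)] only lowers the left side, and then [n] cancels. *)
have key : n%:R * ((1 - e) * X - (`|C| + n.+1%:R) * M%:R) <= n%:R * (n.+1%:R / 2 * L).
  have nR : 1 <= n%:R :> R by rewrite ler1n.
  have MR : 0 <= M%:R :> R by [].
  have CM : C * M%:R <= `|C| * M%:R by rewrite ler_wpM2r // ler_norm.
  have C'M : 0 <= (n%:R - 1) * ((`|C| + n.+1%:R) * M%:R).
    by rewrite mulr_ge0 ?subr_ge0 // mulr_ge0 // addr_ge0.
  have eX : 0 <= (n%:R - 1) * (e * X) by rewrite mulr_ge0 ?subr_ge0 // mulr_ge0 // ltW.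
  have nE : n.+1%:R = n%:R + 1 :> R by rewrite natr1.
  move: main CM C'M eX; rewrite nE; set c := `|C|; clearbody c L X e; clear; lra.
move: key; rewrite ler_pM2l // => key.
apply: (@le_trans _ _ (2 / n.+1%:R * ((1 + eps) * ((1 - e) * X - (`|C| + n.+1%:R) * M%:R)))).
  by rewrite -mulrA ler_wpM2l // divr_ge0.
have -> : (1 + eps) * L = 2 / n.+1%:R * ((1 + eps) * (n.+1%:R / 2 * L)).
  by move: (n.+1%:R : R) d0 => w w0; field; rewrite gt_eqF.
have ep : 0 <= 1 + eps by rewrite addr_ge0 // ltW.
by rewrite ler_wpM2l ?divr_ge0 // ler_wpM2l.
Qed.
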